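(* Let $F$ be the finite field with $q$ elements, let $n\ge 1$ be an integer, and let $\pi=\pi_\theta$ be an irreducible cuspidal representation of $\mathrm{GL}(2n,F)$ associated to a regular character $\theta$ of $F_{2n}^{\times}$, where $F_{2n}$ is the degree $2n$ extension of $F$. Let $N$ be the unipotent radical of the standard parabolic subgroup of $\mathrm{GL}(2n,F)$ of type $(n,n)$. For $0\le k\le n$ let $A_k=\begin{bmatrix} I_k & 0\\ 0 & 0\end{bmatrix}\in \mathrm{M}(n,F)$, and let $\psi_{A_k}$ be the character of $N\simeq \mathrm{M}(n,F)$ given by $\psi_{A_k}(X)=\psi_0(\mathrm{Tr}(A_kX))$, where $\psi_0$ is a fixed non-trivial additive character of $F$. Then for every $0\le k\le n$ the dimension of the twisted Jacquet module $\pi_{N,\psi_{A_k}}$ is $$\dim_{\mathbb{C}}(\pi_{N,\psi_{A_k}})=(-1)^{n-1}(q;q)_{n-1}\, q^{\binom{k}{2}}\,(q^k-1)(q^{k+1}-1)\cdots(q^{n-1}-1).$$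
   Context: Representations are complex and finite-dimensional. $\mathrm{M}(n,F)$ is the set of $n\times n$ matrices over $F$; $I_k$ is the $k\times k$ identity matrix, and $A_0=0$. $N=\left\{\begin{bmatrix}1 & X\\ 0& 1\end{bmatrix} : X\in \mathrm{M}(n,F)\right\}\subset \mathrm{GL}(2n,F)$ is identified with $\mathrm{M}(n,F)$ via $X$. A character $\theta$ of $F_m^\times$ ($F_m$ the degree $m$ extension of $F$) is regular if its $m$ conjugates under $\mathrm{Gal}(F_m/F)$ are distinct. The irreducible cuspidal representations of $\mathrm{GL}(m,F)$ are parametrized (in the standard way) by regular characters $\theta$ of $F_m^\times$, and $\pi_\theta$ denotes the one associated to $\theta$; every irreducible cuspidal representation is of this form. For a representation $(\pi,V)$ and a character $\psi$ of $N$, put $V(N,\psi)=\mathrm{Span}_{\mathbb{C}}\{\pi(n)v-\psi(n)v : n\in N, v\in V\}$. The twisted Jacquet module is $\pi_{N,\psi}=V/V(N,\psi)$; equivalently, it is (isomorphic to) the $\psi$-isotypic component of $\pi|_N$. The $q$-Pochhammer symbol is $(x;q)_m=\prod_{i=0}^{m-1}(1-xq^i)$, with $(x;q)_0=1$. The product $(q^k-1)\cdots(q^{n-1}-1)=\prod_{i=k}^{n-1}(q^i-1)$ is empty, hence equal to $1$, when $k=n$. *)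

(* Defs.v *)
From HB Require Import structures.
From mathcomp Require Import all_boot all_order all_fingroup all_algebra.
From mathcomp Require Import all_solvable all_field mxrepresentation.

Set Implicit Arguments.
Unset Strict Implicit.
Unset Printing Implicit Defensive.

Import GRing.Theory Num.Theory.
Local Open Scope ring_scope.

(* The base field of the representations is an arbitrary numClosedFieldType C;
   the complex numbers R[i] over any real closed field R and algC are
   instances.  As usual for mx_representation, the space of rG of degree d is
   'rV[C]_d, on which g acts by v |-> v *m rG g. *)

(* (x; q)_m *)
Definition qpochhammer (R : pzRingType) (x q : R) (m : nat) : R :=
  \prod_(i < m) (1 - x * q ^+ i).

Section GeneralLinear.

Variables (F : finFieldType) (m : nat).

(* A composition c = (c_1, ..., c_r) of m: its positive parts sum to m. *)
Definition is_composition (c : seq nat) : bool :=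
  (sumn c == m) && all (ltn 0) c.

(* The unipotent radical of the standard (block upper triangular) parabolic
   subgroup of type c; reshape_index c i is the number of the block of c that
   contains the index i. *)
Definition unip_radical (c : seq nat) : {set {'GL_m[F]}} :=
  [set g | [forall i : 'I_m.-1.+1, forall j : 'I_m.-1.+1,
     (reshape_index c i < reshape_index c j)%N
     || (GLval g i j == (i == j)%:R)]].

Variable C : numClosedFieldType.

Section Representation.

Variables (d : nat) (rG : mx_representation C 'GL_m[F] d).

(* No nonzero vector is fixed by the unipotent radical of a proper standard
   parabolic subgroup. *)
Definition cuspidal : Prop :=
  forall c : seq nat, is_composition c -> (1 < size c)%N ->
    rfix_mx rG (unip_radical c) = 0.

(* The row space of rG g - (psi g)%:M is the set of all v g - psi(g) v, so the
   row space of this matrix is V(N, psi). *)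
Definition jacquet_span (N : {set {'GL_m[F]}}) (psi : {'GL_m[F]} -> C) :
    'M[C]_d :=
  (\sum_(g in N) (rG g - (psi g)%:M))%MS.

(* The dimension of V / V(N, psi). *)
Definition twisted_jacquet_dim (N : {set {'GL_m[F]}})
    (psi : {'GL_m[F]} -> C) : nat :=
  (d - \rank (jacquet_span N psi))%N.

End Representation.

Section Parametrization.

Variable L : splittingFieldType F.

(* Characters of the multiplicative group of L; the value at 0 is junk and is
   never used. *)
Definition mult_character (theta : L -> C) : Prop :=
  theta 1 = 1 /\
  (forall x y : L, x != 0 -> y != 0 -> theta (x * y) = theta x * theta y).

(* The Gal(L/F)-conjugates of theta are pairwise distinct. *)
Definition regular_character (theta : L -> C) : Prop :=
  mult_character theta /\
  (forall s t : gal_of {:L}, s \in 'Gal({:L} / 1)%g -> t \in 'Gal({:L} / 1)%g ->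
     (forall x : L, x != 0 -> theta (s x) = theta (t x)) -> s = t).

(* The relation between an irreducible cuspidal representation and theta in
   Green's parametrization, as in Bushnell-Henniart, "The essentially tame
   local Langlands correspondence, I": at every z in L^* generating L over F,
     tr pi_theta(z) = (-1)^(m-1) \sum_(s in Gal(L/F)) theta(s z).
   L^* embeds in GL(m, F) through the choice of an F-basis of L, so z is only
   defined up to conjugacy; its conjugacy class consists of the g whose
   characteristic polynomial vanishes at z. *)
Definition green_parameter d (rG : mx_representation C 'GL_m[F] d)
    (theta : L -> C) : Prop :=
  forall (z : L) (g : {'GL_m[F]}),
    <<1; z>>%VS = {:L}%VS ->
    root (map_poly (in_alg L) (char_poly (GLval g))) z ->
    \tr (rG g) = (-1) ^+ m.-1 * \sum_(s in 'Gal({:L} / 1)%g) theta (s z).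

End Parametrization.

End GeneralLinear.

Definition additive_character (F : finFieldType) (C : numClosedFieldType)
    (psi0 : F -> C) : Prop :=
  psi0 0 = 1 /\ (forall x y : F, psi0 (x + y) = psi0 x * psi0 y).

Section BlockType_n_n.

Variables (F : finFieldType) (n : nat).

(* The upper right n x n block of g, i.e. the X of [1 X; 0 1].  The index type
   of {'GL_(n + n)[F]} is 'I_(n + n).-1.+1, hence the use of inord; for n > 0
   no index is out of range. *)
Definition upper_right (g : {'GL_(n + n)[F]}) : 'M[F]_n :=
  \matrix_(i < n, j < n) GLval g (inord i) (inord (n + j)).

Definition psi_mx (C : numClosedFieldType) (psi0 : F -> C) (A : 'M[F]_n)
    (g : {'GL_(n + n)[F]}) : C :=
  psi0 (\tr (A *m upper_right g)).

End BlockType_n_n.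

(* Main.v *)
Require Import Defs.
From HB Require Import structures.
From mathcomp Require Import all_boot all_order all_fingroup all_algebra.
From mathcomp Require Import all_solvable all_field mxrepresentation.
From mathcomp Require Import zify ring.

Set Implicit Arguments.
Unset Strict Implicit.
Unset Printing Implicit Defensive.

Import GRing.Theory Num.Theory.
Local Open Scope ring_scope.

(** The twisted Jacquet module is the isotypic component of the restriction of
    pi to N, so its dimension is the average over X in M(n, F) of
    psi(- Tr(A_k X)) times the character of pi at [1 X; 0 1] ([isotypic_dim]).
    Everything thus rests on the values of the character at unipotent elements,
    and irreducibility and cuspidality determine these: if u is unipotent in
    GL(s, F) and r = rank(u - 1), the value is
      (-1)^r (q - 1)(q^2 - 1) ... (q^(s - r - 1) - 1).

    Up to a constant factor this comes from the restriction to the mirabolic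
    group of the matrices [1 y; 0 u] ([mirabolic_unipotent]). Expand the
    character as a Fourier series in the row y. The coefficient at a column l
    is 0 for l = 0 by cuspidality, and 0 if u l <> l by conjugation invariance;
    the nonzero fixed columns are all conjugate to the first basis column,
    where the coefficient is again a cuspidal class function, on the mirabolic
    group one size smaller. By induction all the contributing coefficients are
    equal, and the sum of psi(y l) over the nonzero fixed columns is elementary.

    The constant factor is the multiplicity in pi of a generic character of the
    unitriangular group U. It is the rank of the projector e on the
    corresponding isotypic vectors, and it is at most 1 by Gelfand's trick
    ([whittaker_idem_rank]). With the Bruhat decomposition, each double coset
    of U either contributes e pi(g) e = 0 or contains a monomial matrix fixed by
    the transposition with respect to the antidiagonal. This transposition is an
    anti-automorphism that preserves U and its generic character, so all the
    operators e pi(g) e commute; but they span a full matrix algebra of size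
    rank(e). The constant is not 0 since the character does not vanish at the
    identity.

    What remains is a sum over n x n matrices of a character times a weight that
    depends on the rank only ([rank_sum_pidE]). It is evaluated by summing over
    one row at a time: a row on which the character is nontrivial is removed
    together with a column, at the cost of a power of q, and a row on which it
    is trivial at the cost of a difference of two powers of q. *)

(** * Additive characters and sums over subspaces *)

Section AdditiveCharacter.

Variables (F : finFieldType) (C : numClosedFieldType) (psi : F -> C).
Hypothesis psi_char : additive_character psi.
Hypothesis psi_neq1 : exists x : F, psi x != 1.

Local Notation q := (#|F|%:R : C).

Lemma addchar0 : psi 0 = 1. Proof. by case: psi_char. Qed.

Lemma addcharD x y : psi (x + y) = psi x * psi y.
Proof. by case: psi_char => _; apply. Qed.

Lemma addcharNl x : psi (- x) * psi x = 1.
Proof. by rewrite -addcharD addNr addchar0. Qed.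

Lemma addchar_neq0 x : psi x != 0.
Proof. by apply: contraTneq (oner_neq0 C) => p0; rewrite -(addcharNl x) p0 mulr0 eqxx. Qed.

Lemma addcharN_char : additive_character (fun x => psi (- x)).
Proof. by split=> [|x y]; rewrite ?oppr0 ?addchar0 // opprD addcharD. Qed.

Lemma addcharN_neq1 : exists x, psi (- x) != 1.
Proof. by case: psi_neq1 => x px; exists (- x); rewrite opprK. Qed.

Lemma card_field_neq0 : q != 0.
Proof. by rewrite pnatr_eq0 -lt0n; apply/card_gt0P; exists 0. Qed.

(** Translating the summation set by a vector where the character is not 1
    multiplies the sum by a number other than 1 and leaves it unchanged. *)
Lemma sum_char_eq0 a b (S : pred 'M[F]_(a, b)) (phi : 'M[F]_(a, b) -> C) x0 c :
    (forall x, S (x0 + x) = S x) ->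
    (forall x, phi (x0 + x) = c * phi x) -> c != 1 ->
  \sum_(x | S x) phi x = 0.
Proof.
move=> Sx0 phix0 nt_c; set T := \sum_(x | _) _.
have: T = c * T.
  rewrite {1}/T (reindex_inj (addrI x0)) mulr_sumr.
  by apply: eq_big => x; rewrite ?Sx0 ?phix0.
move/eqP; rewrite -subr_eq0 -{1}[T]mul1r -mulrBl mulf_eq0 subr_eq0 eq_sym.
by rewrite (negPf nt_c) => /eqP.
Qed.

Lemma exists_addchar_scale (c : F) : c != 0 -> exists t, psi (t * c) != 1.
Proof.
by case: psi_neq1 => x px c0; exists (x / c); rewrite divfK.
Qed.

(** Characters of a subspace are orthogonal to the trivial one. *)
Lemma sum_addchar_rowspace a b (X : 'M[F]_(a, b)) (l : 'cV[F]_b) :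
  \sum_(x : 'rV[F]_b | (x <= X)%MS) psi ((x *m l) 0 0)
  = if X *m l == 0 then q ^+ \rank X else 0.
Proof.
case: ifPn => [/eqP Xl | nXl].
  rewrite (eq_bigr (fun=> 1)) => [|x /submxP[z ->]]; last first.
    by rewrite -mulmxA Xl mulmx0 mxE addchar0.
  rewrite sumr_const -natrX; congr (_ %:R).
  transitivity #|[set v *m row_base X | v in 'rV[F]_(\rank X)]|.
    apply: eq_card => x; rewrite unfold_in -(eq_row_base X).
    by apply/submxP/imsetP=> [] [u]; exists u.
  rewrite card_imset ?card_mx ?mul1n //.
  have [B AB1] := row_freeP (row_base_free X).
  by apply: can_inj (mulmx^~ B) _ => v; rewrite -mulmxA AB1 mulmx1.
have [i nz_i] : exists i, (X *m l) i 0 != 0.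
  apply/existsP; apply: contraNT nXl; rewrite negb_exists => /forallP Xl0.
  apply/eqP/matrixP=> i j; rewrite ord1 [RHS]mxE; apply/eqP.
  by move/(_ i): Xl0; rewrite negbK.
have [t nt] := exists_addchar_scale nz_i.
apply: (@sum_char_eq0 _ _ _ _ (t *: row i X) (psi (t * (X *m l) i 0))) => [x|x|].
- have Xx0: (t *: row i X <= X)%MS by rewrite scalemx_sub ?row_sub.
  apply/idP/idP=> [Xx|]; last exact: addmx_sub.
  by rewrite -[x](addKr (t *: row i X)) addmx_sub ?eqmx_opp.
- by rewrite mulmxDl mxE addcharD -scalemxAl -row_mul mxE [row _ _ _ _]mxE.
exact: nt.
Qed.

Lemma sum_addchar_kernel a b (X : 'M[F]_(a, b)) (y : 'rV[F]_b) :
  \sum_(l : 'cV[F]_b | X *m l == 0) psi ((y *m l) 0 0)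
  = if (y <= X)%MS then q ^+ (b - \rank X) else 0.
Proof.
rewrite (reindex_onto trmx trmx) => [|l _]; last by rewrite trmxK.
rewrite (eq_bigl (fun l : 'rV_b => (l <= kermx X^T)%MS)) => [|l]; last first.
  by rewrite trmxK eqxx andbT sub_kermx -(inj_eq (@trmx_inj _ _ _)) trmx_mul !trmxK trmx0.
rewrite (eq_bigr (fun l : 'rV_b => psi ((l *m y^T) 0 0))) => [|l _]; last first.
  by rewrite -[l *m _]trmxK trmx_mul trmxK [in RHS]mxE.
rewrite sum_addchar_rowspace mxrank_ker mxrank_tr.
suff -> : (kermx X^T *m y^T == 0) = (y <= X)%MS by [].
apply/eqP/idP => [kXy|/submxP[z ->]]; last first.
  by rewrite trmx_mul mulmxA mulmx_ker mul0mx.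
rewrite submxE; apply/eqP/trmx_inj; rewrite trmx_mul trmx0.
have /submxP[z ->] : ((cokermx X)^T <= kermx X^T)%MS.
  by rewrite sub_kermx -trmx_mul mulmx_coker trmx0.
by rewrite -mulmxA kXy mulmx0.
Qed.

Lemma sum_addchar_col b (y : 'rV[F]_b) :
  \sum_(l : 'cV[F]_b) psi ((y *m l) 0 0) = if y == 0 then q ^+ b else 0.
Proof.
have := sum_addchar_kernel (0 : 'M[F]_(b, b)) y; rewrite mxrank0 subn0 submx0 => <-.
by apply: eq_bigl => l; rewrite mul0mx eqxx.
Qed.

Lemma sum_addchar_row b (l : 'cV[F]_b) :
  \sum_(y : 'rV[F]_b) psi ((y *m l) 0 0) = if l == 0 then q ^+ b else 0.
Proof.
have := sum_addchar_rowspace (1%:M : 'M[F]_b) l; rewrite mxrank1 mul1mx => <-.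
by apply: eq_bigl => y; rewrite submx1.
Qed.

End AdditiveCharacter.

(** * Cuspidal class functions on the mirabolic group *)

Section Mirabolic.

Variables (F : finFieldType) (C : numClosedFieldType) (psi : F -> C).
Hypothesis psi_char : additive_character psi.
Hypothesis psi_neq1 : exists x : F, psi x != 1.

Local Notation q := (#|F|%:R : C).

(** The value at a unipotent u, with r = rank(u - 1), of an irreducible cuspidal
    character of GL(s); this is a polynomial in q that changes by a simple
    factor when r or s does. *)
Definition unipotent_value (s r : nat) : C :=
  (-1) ^+ r * \prod_(1 <= i < s - r) (q ^+ i - 1).

Lemma unipotent_valueS s r :
  unipotent_value s.+1 r.+1 = - unipotent_value s r.
Proof. by rewrite /unipotent_value subSS exprS mulN1r mulNr. Qed.

Lemma unipotent_value_succ s r : (r < s)%N ->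
  unipotent_value s.+1 r = (q ^+ (s - r) - 1) * unipotent_value s r.
Proof.
move=> r_lt_s; rewrite /unipotent_value subSn 1?ltnW // big_nat_recr ?subn_gt0 //=.
by rewrite mulrCA mulrC [in RHS]mulrC [_ - 1]lock -!mulrA; congr (_ * _); rewrite mulrC.
Qed.

Definition mirabolic a (y : 'rV[F]_a) (u : 'M[F]_a) : 'M[F]_(1 + a) :=
  block_mx 1%:M y 0 u.

Definition first_col a : 'cV[F]_(1 + a) := col_mx 1%:M 0.

Lemma mulmx_mirabolic a y u y' u' :
  mirabolic y u *m mirabolic y' u' = mirabolic (y' + y *m u' : 'rV_a) (u *m u').
Proof.
by rewrite mulmx_block !mul1mx !mulmx0 !mul0mx addr0 !add0r.
Qed.

Lemma mirabolic_unit a (y : 'rV_a) u : (mirabolic y u \in unitmx) = (u \in unitmx).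
Proof. by rewrite !unitmxE det_ublock det1 mul1r. Qed.

Lemma mirabolic_first_col a (y : 'rV_a) u : mirabolic y u *m first_col a = first_col a.
Proof. by rewrite mul_block_col !mulmx0 mul0mx !addr0 mulmx1. Qed.

Lemma fix_first_colP a (g : 'M_(1 + a)) :
  g *m first_col a = first_col a -> g = mirabolic (ursubmx g) (drsubmx g).
Proof.
rewrite -{1}(submxK g) mul_block_col !mulmx0 !mulmx1 !addr0.
by case/eq_col_mx => g1 g2; rewrite -{1}(submxK g) g1 g2.
Qed.

(** Conjugation invariance on the mirabolic group, written without inverses. *)
Definition mirabolic_class a (f : 'M[F]_(1 + a) -> C) :=
  forall y u y' u', u \in unitmx -> u' \in unitmx ->
    f (mirabolic y u *m mirabolic y' u') = f (mirabolic y' u' *m mirabolic y u).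

(** As z varies, 1 + D z (1 - D), with D the projection on the first b
    coordinates, runs over the unipotent radical of type (b, 1 + a - b), every
    element being reached the same number of times; summing over all z spares
    a parametrization of the radical. *)
Definition mirabolic_cuspidal a (f : 'M[F]_(1 + a) -> C) :=
  forall b y u, (0 < b <= a)%N -> u \in unitmx ->
    \sum_(z : 'M[F]_(1 + a))
       f ((1%:M + pid_mx b *m z *m copid_mx b) *m mirabolic y u) = 0.

Definition first_coord a (y : 'rV[F]_(1 + a)) : F := (y *m first_col a) 0 0.

(** The Fourier coefficient of f along the first row, at the character that
    reads off the first coordinate. It is considered on matrices u fixing the
    first basis column, that is on the mirabolic group one size smaller, which
    is the stabilizer of that character. *)
Definition whittaker_step a (f : 'M[F]_(1 + (1 + a)) -> C) (u : 'M[F]_(1 + a)) : C :=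
  (q ^+ (1 + a))^-1 * \sum_y psi (- first_coord y) * f (mirabolic y u).

(** Iterating the step down to size 1 gives the coefficient of f along the
    unitriangular group at a generic character. *)
Fixpoint whittaker a : ('M[F]_(1 + a) -> C) -> C :=
  match a with
  | 0 => fun f => f 1%:M
  | a'.+1 => fun f => whittaker (@whittaker_step a' f)
  end.

Lemma first_coordD a (y y' : 'rV[F]_(1 + a)) :
  first_coord (y + y') = first_coord y + first_coord y'.
Proof. by rewrite /first_coord mulmxDl mxE. Qed.

Lemma sum_block_mx_eq0 a (h : 'rV[F]_a -> 'M[F]_a -> C) :
    \sum_(z : 'M[F]_(1 + a)) h (ursubmx z) (drsubmx z) = 0 ->
  \sum_w \sum_z h w z = 0.
Proof.
pose blk (t : ('M[F]_1 * 'cV[F]_a) * ('rV[F]_a * 'M[F]_a)) : 'M[F]_(1 + a) :=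
  block_mx t.1.1 t.2.1 t.1.2 t.2.2.
rewrite (reindex blk) /=; last first.
  exists (fun z => ((ulsubmx z, dlsubmx z), (ursubmx z, drsubmx z))).
    case=> [[? ?] [? ?]] _; rewrite /blk /= block_mxKul block_mxKdl.
    by rewrite block_mxKur block_mxKdr.
  by move=> z _; rewrite /blk /= submxK.
rewrite (eq_bigr (fun t => h t.2.1 t.2.2)) => [|t _]; last first.
  by rewrite /blk block_mxKur block_mxKdr.
rewrite -(pair_bigA _ (fun i j => h j.1 j.2)) /= sumr_const.
move/eqP; rewrite mulrn_eq0 => /orP[|/eqP]; last by rewrite -(pair_bigA _ h).
by rewrite eqn0Ngt; case/negP; apply/card_gt0P; exists (0, 0).
Qed.

Lemma pid_mxS_block m a b :
  pid_mx b.+1 = block_mx 1%:M 0 0 (pid_mx b) :> 'M[F]_(1 + m, 1 + a).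
Proof.
apply/matrixP=> i j; rewrite !mxE.
by case: splitP => i' ->; rewrite mxE; case: splitP => j' ->; rewrite mxE ?ord1.
Qed.

Section Step.

Variables (a : nat) (f : 'M[F]_(1 + (1 + a)) -> C).
Let f' := whittaker_step f.

Lemma whittaker_step_class : mirabolic_class f -> mirabolic_class f'.
Proof.
move=> f_class y1 u1 y2 u2 U1 U2; rewrite /f' /whittaker_step; congr (_ * _).
set g := mirabolic y1 u1; set h := mirabolic y2 u2.
have Ug : g \in unitmx by rewrite mirabolic_unit.
have Uh : h \in unitmx by rewrite mirabolic_unit.
rewrite [RHS](reindex (mulmx^~ g)) /=; last first.
  by exists (mulmx^~ (invmx g)) => y _; rewrite ?mulmxK ?mulmxKV.
apply: eq_bigr => y _; congr (psi (- _) * _).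
  by rewrite /first_coord -mulmxA mirabolic_first_col.
have -> : mirabolic y (g *m h) = mirabolic 0 g *m mirabolic y h.
  by rewrite mulmx_mirabolic mul0mx addr0.
by rewrite f_class // mulmx_mirabolic add0r.
Qed.

(** The radical of rank b for the step sits inside the radical of rank b + 1
    for f: what it lacks is the translations of the first row by the
    vectors supported on the last columns, whose first coordinate vanishes, so
    that these do not change the Fourier coefficient. *)
Lemma whittaker_step_cuspidal : mirabolic_cuspidal f -> mirabolic_cuspidal f'.
Proof.
move=> f_cusp b y' u' /andP[b_gt0 b_le_a] U'; set u := mirabolic y' u'.
have Uu : u \in unitmx by rewrite mirabolic_unit.
pose n (z : 'M[F]_(1 + a)) := 1%:M + pid_mx b *m z *m copid_mx b.
pose h (w : 'rV[F]_(1 + a)) z y := f (mirabolic (y + w *m copid_mx b *m u) (n z *m u)).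
have h0 y : \sum_w \sum_z h w z y = 0.
  apply: (sum_block_mx_eq0 (h := fun w z => h w z y)).
  rewrite -[RHS](f_cusp b.+1 y u) ?ltnS // ; apply: eq_bigr => z _.
  rewrite /h; congr f; rewrite -{3}[z]submxK /copid_mx pid_mxS_block.
  rewrite (@scalar_mx_block _ 1 (1 + a)) opp_block_mx add_block_mx !subrr.
  rewrite !mulmx_block add_block_mx.
  rewrite !mul1mx !mul0mx !mulmx0 !addr0 !add0r.
  by rewrite -/(mirabolic _ _) mulmx_mirabolic.
pose T w := \sum_z \sum_y psi (- first_coord y) * h w z y.
have sumT : \sum_w T w = 0.
  rewrite /T; under eq_bigr do rewrite exchange_big /=.
  rewrite exchange_big big1 //= => y _.
  by under eq_bigr do rewrite -mulr_sumr; rewrite -mulr_sumr h0 mulr0.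
have eqT w : T w = T 0.
  apply: eq_bigr => z _.
  rewrite [RHS](reindex_inj (addrI (w *m copid_mx b *m u))).
  apply: eq_bigr => y _; congr (psi (- _) * _); rewrite /h.
    rewrite first_coordD /first_coord -[_ *m u *m _]mulmxA mirabolic_first_col.
    case: b b_gt0 {b_le_a n h h0 T sumT} => // b _.
    rewrite /copid_mx pid_mxS_block (@scalar_mx_block _ 1 a) opp_block_mx add_block_mx.
    rewrite !subrr -mulmxA mul_block_col.
    by rewrite !mul0mx !mulmx0 !addr0 col_mx0 mulmx0 [X in X + _]mxE add0r.
  by rewrite !mul0mx addr0 addrC.
move: sumT; rewrite (eq_bigr _ (fun w _ => eqT w)) sumr_const => /eqP.
rewrite mulrn_eq0 eqn0Ngt => /orP[/negP[]|/eqP T0].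
  by apply/card_gt0P; exists 0.
rewrite /f' /whittaker_step -mulr_sumr; apply/eqP; rewrite mulf_eq0; apply/orP; right.
apply/eqP; rewrite -[RHS]T0; apply: eq_bigr => z _; apply: eq_bigr => y _.
by rewrite /h !mul0mx addr0.
Qed.

Section Fourier.

Variable u : 'M[F]_(1 + a).
Hypothesis Uu : u \in unitmx.
Let coef (l : 'cV[F]_(1 + a)) := \sum_y psi (- (y *m l) 0 0) * f (mirabolic y u).

Lemma fourier_inversion y :
  q ^+ (1 + a) * f (mirabolic y u) = \sum_l psi ((y *m l) 0 0) * coef l.
Proof.
under eq_bigr do rewrite mulr_sumr; rewrite exchange_big /=.
rewrite (bigD1 y) //= [X in _ + X]big1 ?addr0 => [|y' ne_y].
  rewrite (eq_bigr (fun=> f (mirabolic y u))) => [|l _].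
    by rewrite sumr_const card_mx muln1 -natrX mulr_natl.
  by rewrite mulrA [psi _ * _]mulrC addcharNl ?mul1r.
rewrite (eq_bigr (fun l => psi (((y - y') *m l) 0 0) * f (mirabolic y' u))) => [|l _].
  by rewrite -mulr_suml sum_addchar_col // subr_eq0 eq_sym (negPf ne_y) mul0r.
by rewrite mulrA -addcharD // mulmxBl !mxE.
Qed.

(** The first rows form the unipotent radical of type (1, 1 + a), so the trivial
    character does not occur. *)
Lemma fourier_coef0 : mirabolic_cuspidal f -> coef 0 = 0.
Proof.
move=> f_cusp; have := f_cusp 1 0 u; rewrite ltnS => /(_ isT Uu).
pose h (w : 'rV[F]_(1 + a)) (z : 'M[F]_(1 + a)) := f (mirabolic (w *m u) u).
rewrite (eq_bigr (fun z => h (ursubmx z) (drsubmx z))) => [|z _]; last first.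
  rewrite /h; congr f; rewrite -{1}[z]submxK /copid_mx pid_mxS_block pid_mx_0.
  rewrite (@scalar_mx_block _ 1 (1 + a)) opp_block_mx add_block_mx !subrr.
  rewrite !mulmx_block add_block_mx.
  rewrite !mul1mx !mul0mx !mulmx0 oppr0 !addr0 !add0r mulmx1.
  by rewrite -/(mirabolic _ _) mulmx_mirabolic add0r mul0mx addr0 mul1mx.
move/sum_block_mx_eq0; rewrite {}/h; under eq_bigr do rewrite sumr_const.
rewrite sumrMnl => /eqP; rewrite mulrn_eq0 => /orP[|/eqP sum0].
  by rewrite eqn0Ngt; case/negP; apply/card_gt0P; exists 0.
rewrite -[RHS]sum0 /coef (reindex (mulmx^~ u)) /=; last first.
  by exists (mulmx^~ (invmx u)) => y _; rewrite ?mulmxK ?mulmxKV.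
by apply: eq_bigr => y _; rewrite mulmx0 mxE oppr0 addchar0 // mul1r.
Qed.

(** Conjugating by a translation multiplies the coefficient at l by a value
    of the character, which can be made different from 1 unless u fixes l. *)
Lemma fourier_coef_moved l : mirabolic_class f -> u *m l != l -> coef l = 0.
Proof.
move=> f_class; rewrite -subr_eq0 -{2}[l]mul1mx -mulmxBl => nz_ul.
have [w nz_w] : exists w : 'rV[F]_(1 + a), psi (- (w *m (u - 1%:M) *m l) 0 0) != 1.
  have [i nz_i] : exists i, ((u - 1%:M) *m l) i 0 != 0.
    apply/existsP; apply: contraNT nz_ul; rewrite negb_exists => /forallP ul0.
    apply/eqP/matrixP=> i j; rewrite ord1 [RHS]mxE; apply/eqP.
    by move/(_ i): ul0; rewrite negbK.
  have [t nt] := exists_addchar_scale (addcharN_neq1 psi_neq1) nz_i.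
  exists (t *: delta_mx 0 i); rewrite -mulmxA -scalemxAl -rowE mxE.
  by rewrite [row _ _ _ _]mxE.
apply: (@sum_char_eq0 F C _ _ xpredT _ (w *m (u - 1%:M)) _ _ _ nz_w) => // y.
rewrite mulmxDl mxE opprD addcharD // -mulrA; congr (_ * (_ * _)).
have -> : mirabolic (w *m (u - 1%:M) + y) u = mirabolic w 1%:M *m mirabolic (y - w) u.
  by rewrite mulmx_mirabolic mul1mx mulmxBr mulmx1 addrC addrA addrAC.
by rewrite f_class ?unitmx1 // mulmx_mirabolic !mulmx1 addrC subrK.
Qed.

(** Conjugation by h moves the character l = h e_1 to the one used in the step;
    every nonzero l has this form, so all remaining coefficients come from the
    smaller mirabolic group. *)
Lemma fourier_coef_fixed h : mirabolic_class f -> h \in unitmx ->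
  coef (h *m first_col a) = q ^+ (1 + a) * f' (invmx h *m u *m h).
Proof.
move=> f_class Uh; rewrite /f' /whittaker_step mulrA divff ?mul1r; last first.
  by rewrite expf_neq0 // card_field_neq0.
rewrite /coef (reindex (mulmx^~ (invmx h))) /=; last first.
  by exists (mulmx^~ h) => y _; rewrite ?mulmxK ?mulmxKV.
apply: eq_bigr => y _; rewrite mulmxA mulmxKV //; congr (_ * _).
have Uh' : invmx h \in unitmx by rewrite unitmx_inv.
have -> : mirabolic (y *m invmx h) u
   = mirabolic 0 h *m mirabolic (y *m invmx h) (invmx h *m u).
  by rewrite mulmx_mirabolic mul0mx addr0 mulKVmx.
rewrite f_class ?unitmx_mul ?Uh' // mulmx_mirabolic add0r.
by rewrite -mulmxA mulVmx // mulmx1.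
Qed.

End Fourier.

End Step.

Lemma unitmx_first_col a (l : 'cV[F]_(1 + a)) : l != 0 ->
  exists2 h, h \in unitmx & h *m first_col a = l.
Proof.
move=> nz_l; have rk_l : \rank l = 1%N by rewrite -mxrank_tr rank_rV trmx_eq0 nz_l.
exists (row_ebase l 0 0 *: col_ebase l).
  rewrite unitmxZ ?col_ebase_unit // -[row_ebase l 0 0]det_mx11 -unitmxE.
  exact: row_ebase_unit.
rewrite -[RHS]mulmx_ebase rk_l pid_mx_col [row_ebase l in RHS]mx11_scalar.
by rewrite mul_mx_scalar scalemxAl.
Qed.

Lemma nilpotent_block a (y : 'rV[F]_a) (X : 'M[F]_a) k :
  exists z w, (block_mx 0 y 0 X : 'M_(1 + a)) ^+ k = block_mx z w 0 (X ^+ k).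
Proof.
elim: k => [|k [z [w IHk]]].
  by exists 1%:M, 0; rewrite !expr0 -[1]/(1%:M : 'M_(1 + a)) scalar_mx_block.
exists 0, (z *m y + w *m X); rewrite [LHS]exprSr IHk -[LHS]/(_ *m _) mulmx_block.
by rewrite !mulmx0 !mul0mx !addr0 add0r -[X ^+ k *m X]/(X ^+ k * X) -exprSr.
Qed.

Lemma nilpotent_rank_lt a (X : 'M[F]_(1 + a)) k : X ^+ k = 0 -> (\rank X < 1 + a)%N.
Proof.
move=> Xk0; rewrite ltn_neqAle rank_leq_row andbT; apply/negP => X_free.
have UX : X \is a GRing.unit by rewrite -[_ \is a _]/(X \in unitmx) -row_free_unit.
by have := unitrX k UX; rewrite Xk0 unitr0.
Qed.

Lemma unipotent_unit a (u : 'M[F]_(1 + a)) k : (u - 1%:M) ^+ k = 0 -> u \in unitmx.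
Proof.
move=> nil_u; have := subrX1 (1 - u) k.
have -> : (1 - u) ^+ k = 0 by rewrite -opprB exprNn [X in _ * X]nil_u mulr0.
rewrite sub0r addrAC subrr sub0r mulNr => /oppr_inj u_inv.
by case: (mulmx1_unit (esym u_inv)).
Qed.

Lemma mxrank_col_row m p (y : 'rV[F]_p) (X : 'M[F]_(m, p)) :
  \rank (col_mx y X) = (\rank X + ~~ (y <= X)%MS)%N.
Proof.
rewrite -addsmxE; have [/addsmx_idPr-> | nyX] /= := boolP (y <= X)%MS.
  by rewrite addn0.
apply/eqP; rewrite eqn_leq addn1; apply/andP; split.
  rewrite (leq_trans (mxrank_adds_leqif _ _)) // -[(\rank X).+1]add1n leq_add2r.
  exact: rank_leq_row.
rewrite (ltn_leqif (mxrank_leqif_sup (addsmxSr y X))) addsmx_sub submx_refl andbT.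
exact: nyX.
Qed.

Lemma mxrank_conjg a (X h : 'M[F]_a) : h \in unitmx ->
  \rank (invmx h *m X *m h) = \rank X.
Proof.
move=> Uh; rewrite mxrankMfree ?row_free_unit // -mxrank_tr trmx_mul.
by rewrite mxrankMfree ?row_free_unit ?unitmx_tr ?unitmx_inv // mxrank_tr.
Qed.

Lemma conj_exprmx a (X h : 'M[F]_(1 + a)) k : h \in unitmx ->
  (invmx h *m X *m h) ^+ k = invmx h *m X ^+ k *m h.
Proof.
move=> Uh; elim: k => [|k IHk]; first by rewrite !expr0 mulmx1 mulVmx.
by rewrite !exprS IHk -![_ * _]/(_ *m _) !mulmxA mulmxK.
Qed.

(** Only the nonzero columns l fixed by u contribute to the Fourier expansion of
    f along the first row y, and by induction each contributes psi(y l) times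
    the same constant, because rank(u - 1) is invariant under conjugation. The
    character sum over the kernel of u - 1 then depends only on whether y lies
    in the row space of u - 1, that is on the rank of the whole matrix minus 1.
    Unipotence is what makes u - 1 singular, so that the exponent in
    q ^ (size - rank) is positive. *)
Lemma mirabolic_unipotent a (f : 'M[F]_(1 + a) -> C) (g : 'M[F]_(1 + a)) k :
    mirabolic_class f -> mirabolic_cuspidal f ->
    g *m first_col a = first_col a -> (g - 1%:M) ^+ k = 0 ->
  f g = whittaker f * unipotent_value a.+1 (\rank (g - 1%:M)).
Proof.
elim: a f g => [|a IHa] f g f_class f_cusp /fix_first_colP ->.
  move=> _; set g' := mirabolic _ _; have -> : g' = 1%:M.
    rewrite (@scalar_mx_block _ 1 0); congr (block_mx _ _ _ _).
      exact: thinmx0.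
    exact: etrans (flatmx0 _) (esym (flatmx0 _)).
  by rewrite subrr mxrank0 /unipotent_value big_geq // !mulr1.
move: (ursubmx g) (drsubmx g) => {g} y u.
set X : 'M_(1 + a) := u - 1%:M.
have -> : mirabolic y u - 1%:M = block_mx 0 y 0 X.
  by rewrite (@scalar_mx_block _ 1 (1 + a)) opp_block_mx add_block_mx subrr !subr0.
have [z [w ->]] := nilpotent_block y X k; rewrite -[0 in RHS](@block_mx0 _ 1 _ 1).
case/eq_block_mx => _ _ _ nilX; have Uu := unipotent_unit nilX.
pose K := whittaker f * unipotent_value a.+1 (\rank X).
pose coef (l : 'cV[F]_(1 + a)) := \sum_y psi (- (y *m l) 0 0) * f (mirabolic y u).
have coefE l : coef l = if (l == 0) || (X *m l != 0) then 0 else q ^+ (1 + a) * K.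
  case: eqP => [->|/eqP/unitmx_first_col[h Uh <-]] /=; first exact: fourier_coef0.
  have [Xl0|nz_Xl] := eqVneq (X *m (h *m first_col a)) 0; last first.
    apply: fourier_coef_moved => //.
    by rewrite -subr_eq0 -{2}[h *m _]mul1mx -mulmxBl.
  rewrite /coef fourier_coef_fixed //; congr (_ * _).
  have XhE : invmx h *m u *m h - 1%:M = invmx h *m X *m h.
    by rewrite mulmxBr mulmxBl mulmx1 mulVmx.
  rewrite (IHa (whittaker_step f)); first by rewrite XhE mxrank_conjg.
  - exact: whittaker_step_class.
  - exact: whittaker_step_cuspidal.
  - apply/eqP; rewrite -subr_eq0 -{2}[first_col a]mul1mx -mulmxBl XhE.
    by rewrite -!mulmxA Xl0 mulmx0.
  by rewrite XhE conj_exprmx // nilX mulmx0 mul0mx.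
have: q ^+ (1 + a) * f (mirabolic y u)
    = q ^+ (1 + a)
      * (K * (\sum_(l : 'cV[F]_(1 + a) | X *m l == 0) psi ((y *m l) 0 0) - 1)).
  rewrite fourier_inversion // (bigID (fun l => X *m l == 0)) /=.
  rewrite [X in _ + X]big1 ?addr0 => [|l nz_Xl]; last first.
    by rewrite -/(coef l) coefE nz_Xl orbT mulr0.
  rewrite [LHS](bigD1 0) ?mulmx0 //= [X in K * (X - 1)](bigD1 0) ?mulmx0 //=.
  rewrite mxE addchar0 // addrAC subrr add0r -/(coef 0) coefE eqxx mulr0 add0r.
  rewrite mulrA mulr_sumr; apply: eq_bigr => l /andP[/eqP Xl0 nz_l].
  by rewrite -/(coef l) coefE (negPf nz_l) Xl0 eqxx mulrC.
have nz_q : q ^+ (1 + a) != 0 by rewrite expf_neq0 // card_field_neq0.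
move/(mulfI nz_q) => ->; rewrite sum_addchar_kernel //.
have -> : block_mx 0 y 0 X = row_mx 0 (col_mx y X) :> 'M_(1 + (1 + a)).
  by rewrite block_mxEh col_mx0.
have rX := nilpotent_rank_lt nilX.
rewrite rank_row_0mx mxrank_col_row; case: ifPn => [yX | nyX] /=; last first.
  by rewrite addn1 unipotent_valueS sub0r mulrN mulr1 mulrN.
by rewrite addn0 unipotent_value_succ // mulrCA [RHS]mulrC.
Qed.

End Mirabolic.

(** * Character sums over rectangular matrices, weighted by rank *)

Section RankSum.

Variables (F : finFieldType) (C : numClosedFieldType) (psi : F -> C).
Hypothesis psi_char : additive_character psi.
Hypothesis psi_neq1 : exists x : F, psi x != 1.

Local Notation q := (#|F|%:R : C).
Local Notation uval := (unipotent_value F C).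

Definition rank_sum a b k s : C :=
  \sum_(X : 'M[F]_(a, b)) psi (\tr (pid_mx k *m X)) * uval s (\rank X).

Lemma sum_col_mx a b (h : 'M[F]_(1 + a, b) -> C) :
  \sum_X h X = \sum_(X : 'M[F]_(a, b)) \sum_(x : 'rV[F]_b) h (col_mx x X).
Proof.
rewrite pair_bigA (reindex (fun p : 'M_(a, b) * 'rV_b => col_mx p.2 p.1)) //=.
exists (fun X => (dsubmx X, usubmx X)) => [[X x] _ | X _] /=.
  by rewrite col_mxKd col_mxKu.
by rewrite vsubmxK.
Qed.

(** A row x added on top of X raises the rank unless x is in the row space of X.
    For the weights at hand both contributions are multiples of one weight of
    size smaller by one, which is why the sums below telescope. *)
Lemma sum_row_uval a b t (X : 'M[F]_(a, b)) (l : 'cV[F]_b) : (\rank X < t)%N ->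
  \sum_(x : 'rV[F]_b) psi ((x *m l) 0 0) * uval t.+1 (\rank (col_mx x X))
  = ((if X *m l == 0 then q ^+ t else 0) - (if l == 0 then q ^+ b else 0))
    * uval t (\rank X).
Proof.
move=> r_lt_t; set r := \rank X; have r_le_t := ltnW r_lt_t.
have uvalE (x : 'rV_b) : uval t.+1 (\rank (col_mx x X))
    = (if (x <= X)%MS then q ^+ (t - r) * uval t r else 0) - uval t r.
  rewrite mxrank_col_row -/r; case: ifP => _ /=.
    by rewrite addn0 unipotent_value_succ // mulrBl mul1r.
  by rewrite addn1 unipotent_valueS sub0r.
under eq_bigr do rewrite uvalE mulrBr.
rewrite sumrB -mulr_suml sum_addchar_row // mulrBl; congr (_ - _).
rewrite (bigID (fun x : 'rV_b => (x <= X)%MS)) /=.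
rewrite [X in _ + X]big1 => [|x /negPf->]; last first.
  by rewrite mulr0.
rewrite addr0 (eq_bigr (fun x : 'rV_b =>
  psi ((x *m l) 0 0) * (q ^+ (t - r) * uval t r))) => [|x ->] //.
rewrite -mulr_suml sum_addchar_rowspace // mulrA; case: ifP => _; rewrite ?mul0r //.
by rewrite -exprD subnKC.
Qed.

Lemma rank_sum0_recl a b t : (a < t)%N ->
  rank_sum (1 + a) b 0 t.+1 = (q ^+ t - q ^+ b) * rank_sum a b 0 t.
Proof.
move=> a_lt_t; rewrite /rank_sum sum_col_mx mulr_sumr; apply: eq_bigr => X _.
rewrite !pid_mx_0 mul0mx mxtrace0 addchar0 // mul1r.
have := @sum_row_uval a b t X 0; rewrite mulmx0 !eqxx => <-; last first.
  exact: leq_ltn_trans (rank_leq_row X) a_lt_t.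
by apply: eq_bigr => x _; rewrite mul0mx mulmx0 mxtrace0 mxE.
Qed.

(** The character sum over the first row forces the first column of the
    remaining rows to vanish, so a row and a column disappear together. *)
Lemma rank_sum_recl a b k t : (a < t)%N ->
  rank_sum (1 + a) (1 + b) k.+1 t.+1 = q ^+ t * rank_sum a b k t.
Proof.
move=> a_lt_t; rewrite /rank_sum sum_col_mx.
have trE (x : 'rV[F]_(1 + b)) (X : 'M[F]_(a, 1 + b)) :
    \tr (pid_mx k.+1 *m col_mx x X)
    = (x *m first_col F b) 0 0 + \tr (pid_mx k *m rsubmx X).
  rewrite -[col_mx x X]submxK pid_mxS_block mulmx_block mxtrace_block.
  rewrite !mul1mx !mul0mx add0r addr0.
  rewrite /ulsubmx /drsubmx col_mxKu col_mxKd trace_mx11 -[in RHS](hsubmxK x).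
  by rewrite mul_row_col mulmx1 mulmx0 addr0.
have nz_e : first_col F b != 0 by rewrite col_mx_eq0 oner_eq0.
transitivity (\sum_(X : 'M[F]_(a, 1 + b) | X *m first_col F b == 0)
    q ^+ t * (psi (\tr (pid_mx k *m rsubmx X)) * uval t (\rank X))).
  rewrite [RHS]big_mkcond; apply: eq_bigr => X _.
  under eq_bigr do rewrite trE addcharD // mulrAC.
  rewrite -mulr_suml sum_row_uval ?(leq_ltn_trans (rank_leq_row X)) //.
  by rewrite (negPf nz_e) subr0; case: eqP => _; rewrite ?mul0r // mulrAC mulrA.
rewrite -mulr_sumr; congr (_ * _).
rewrite (reindex_onto (fun X : 'M_(a, b) => row_mx 0 X : 'M_(a, 1 + b)) rsubmx) /=.
  apply: eq_big => [X|X _].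
    by rewrite row_mxKr eqxx andbT mul_row_col mul0mx mulmx0 addr0 eqxx.
  by rewrite row_mxKr rank_row_0mx.
move=> X /eqP; rewrite -{1}[X]hsubmxK mul_row_col mulmx1 mulmx0 addr0 => X0.
by rewrite -[RHS]hsubmxK X0.
Qed.

(** The k rows carrying the character are removed first, together with k
    columns, then the n - k free rows; the powers of q collected on the way add
    up to n * n + C(k, 2). *)
Lemma rank_sum_pidE n k : (0 < n)%N -> (k <= n)%N ->
  rank_sum n n k (n + n)
  = q ^+ (n * n) * (q ^+ 'C(k, 2)
    * (\prod_(k <= i < n) (q ^+ i - 1) * \prod_(1 <= i < n) (q ^+ i - 1))).
Proof.
move=> n_gt0 k_le_n; set m := (n - k)%N.
(* The exponent of q is t + (t + 1) + ... + (t + j - 1). *)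
have step_k j t : (m < t)%N ->
    rank_sum (j + m) (j + m) j (j + t) = q ^+ (j * t + 'C(j, 2)) * rank_sum m m 0 t.
  move=> m_lt_t; elim: j => [|j IHj]; first by rewrite expr0 mul1r.
  rewrite -[RHS]/(_ * _) (@rank_sum_recl (j + m) (j + m) j (j + t)) ?ltn_add2l //.
  by rewrite IHj mulrA -exprD; congr (q ^+ _ * _); rewrite binS bin1; lia.
have step_0 a : rank_sum a m 0 (a + n)
    = \prod_(i < a) (q ^+ (i + n) - q ^+ m) * \prod_(1 <= i < n) (q ^+ i - 1).
  elim: a => [|a IHa].
    rewrite big_ord0 mul1r /rank_sum (big_pred1 0) => [|X]; last first.
      by apply/esym/eqP; exact: flatmx0.
    by rewrite mulmx0 mxtrace0 addchar0 // mul1r mxrank0 /unipotent_value mul1r subn0.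
  rewrite (@rank_sum0_recl a m (a + n)) ?IHa ?big_ord_recr /= ?mulrA.
    by rewrite [_ * (q ^+ _ - _)]mulrC.
  by lia.
have -> : rank_sum n n k (n + n) = rank_sum (k + m) (k + m) k (k + (m + n)).
  by rewrite addnA /m subnKC.
rewrite step_k ?step_0; last by lia.
have -> : \prod_(k <= i < n) (q ^+ i - 1) = \prod_(i < m) (q ^+ (i + k) - 1).
  by rewrite -{1}[k]add0n big_addn big_mkord.
rewrite (eq_bigr (fun i : 'I_m => q ^+ m * (q ^+ (i + k) - 1))) => [|i _].
  rewrite big_split /= prodr_const card_ord -exprM !mulrA -!exprD.
  congr (q ^+ _ * _ * _); have nE : n = (m + k)%N by rewrite subnK.
  by rewrite nE; move: (m) 'C(k, 2) => *; ring.
by rewrite mulrBr mulr1 -exprD; congr (q ^+ _ - _); lia.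
Qed.

End RankSum.

(** * Permutations all of whose descents are by one *)

Section DecreasingBlocks.

Variables (T : Type) (s : nat) (f : nat -> nat) (t : nat -> T).
Hypothesis f_lt : forall i, (i < s)%N -> (f i < s)%N.
Hypothesis f_inj : forall i j, (i < s)%N -> (j < s)%N -> f i = f j -> i = j.
Hypothesis f_descent : forall i, (i.+1 < s)%N -> (f i.+1 < f i)%N ->
  f i = (f i.+1).+1 /\ t i = t i.+1.

(** Between the two ends of an inversion the function decreases with slope -1:
    an ascent just after i would have to be undone by unit steps down to f j,
    which would take the value f i a second time. *)
Lemma inversion_slope i j : (i < j < s)%N -> (f j < f i)%N ->
  forall k, (i <= k <= j)%N -> (f k + k = f i + i)%N /\ t k = t i.
Proof.
move=> /andP[]; have [d] := ubnP (j - i); elim: d i => // d IHd i.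
move=> le_d lt_ij lt_js lt_f k /andP[le_ik le_kj].
have := lt_ij; rewrite leq_eqVlt => /orP[/eqP eq_j|lt_i1j].
  have [fi ti] : f i = (f i.+1).+1 /\ t i = t i.+1 by apply: f_descent; rewrite eq_j.
  have /orP[/eqP->|/eqP->] // : (k == i) || (k == i.+1) by lia.
  by split=> //; lia.
have lt_i1s : (i.+1 < s)%N by lia.
have lt_d : (j - i.+1 < d)%N by lia.
have ne_j : f i.+1 <> f j by move/f_inj => eq; lia.
have ne_i : f i.+1 <> f i by move/f_inj => eq; lia.
have [lt_f1|le_f1] := ltnP (f i.+1) (f i).
  have [fi ti] := f_descent lt_i1s lt_f1.
  have [-> //|ne_k] := eqVneq k i.
  have lt_fj1 : (f j < f i.+1)%N by lia.
  have [|fk ->] := IHd i.+1 lt_d lt_i1j lt_js lt_fj1 k; first lia.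
  by split=> //; lia.
have lt_fj1 : (f j < f i.+1)%N by lia.
have IH := IHd i.+1 lt_d lt_i1j lt_js lt_fj1.
(* The position where the descent from i.+1 to j would take the value f i. *)
pose r := (f i.+1 + i.+1 - f i)%N.
have [|fj _] := IH j; first lia.
have [|fr _] := IH r; first by rewrite /r; lia.
by have /f_inj : f r = f i; rewrite /r in fr *; lia.
Qed.

Lemma pigeonhole_stable (A : seq nat) j : uniq A -> {subset A <= gtn s} ->
  (j < s)%N -> j \notin A -> f j \in A -> ~~ all (fun i => f i \in A) A.
Proof.
move=> uA sA j_lt nAj Afj; apply/negP => /allP fA.
have: (size (map f (j :: A)) <= size A)%N.
  apply: uniq_leq_size => [|_ /mapP[i Ai ->]]; last first.
    by move: Ai; rewrite inE => /predU1P[->//|]; apply: fA.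
  rewrite map_inj_in_uniq /= ?nAj // => i k Ai Ak; apply: f_inj.
    by move: Ai; rewrite inE => /predU1P[->//|]; apply: sA.
  by move: Ak; rewrite inE => /predU1P[->//|]; apply: sA.
by rewrite size_map /= ltnn.
Qed.

(** Such a permutation reverses consecutive blocks, hence is an involution. If
    i < v = f i, the positions from v on cannot all have values at least v,
    since v itself is taken at i; so i begins an inversion that reaches v, and
    the slope gives f v = i. The case v < i is symmetric. *)
Lemma block_reversal i : (i < s)%N -> f (f i) = i /\ t (f i) = t i.
Proof.
move=> lt_is; set v := f i; have lt_vs : (v < s)%N by apply: f_lt.
have [lt_iv|lt_vi|eq_iv] := ltngtP i v; last by rewrite -eq_iv.
  have /allPn[j] : ~~ all (fun k => f k \in iota v (s - v)) (iota v (s - v)).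
    apply: (pigeonhole_stable (j := i)); [exact: iota_uniq | move=> k | by [] | |].
    + by rewrite mem_iota inE /=; lia.
    + by rewrite mem_iota; lia.
    by rewrite mem_iota -/v; lia.
  rewrite !mem_iota => j_ge fj; have ltfj : (f j < s)%N by apply: f_lt; lia.
  have lt_ij : (i < j < s)%N by lia.
  have lt_f : (f j < f i)%N by rewrite -/v; lia.
  have [|fv tv] := inversion_slope lt_ij lt_f (k := v); first by lia.
  by split=> //; rewrite -/v in fv; lia.
have /allPn[j] : ~~ all (fun k => f k \in iota 0 v.+1) (iota 0 v.+1).
  apply: (pigeonhole_stable (j := i)); [exact: iota_uniq | move=> k | by [] | |].
  + by rewrite mem_iota inE /=; lia.
  + by rewrite mem_iota; lia.
  by rewrite mem_iota -/v; lia.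
rewrite !mem_iota => j_le fj.
have lt_ji : (j < i < s)%N by lia.
have lt_f : (f i < f j)%N by rewrite -/v; lia.
have [|fv tv] := inversion_slope lt_ji lt_f (k := v); first by lia.
have [|fi ti] := inversion_slope lt_ji lt_f (k := i); first by lia.
by split; [rewrite -/v in fi; lia | rewrite tv ti].
Qed.

End DecreasingBlocks.

(** * Unitriangular matrices and the antitranspose *)

Section Unitriangular.

Variable F : finFieldType.

Definition unitri s (u : 'M[F]_s) : bool :=
  [forall i : 'I_s, forall j : 'I_s, (j <= i)%N ==> (u i j == (i == j)%:R)].

Definition superdiag_sum s (u : 'M[F]_s) : F :=
  \sum_(i < s) \sum_(j < s | j == i.+1 :> nat) u i j.

Lemma unitriP s (u : 'M[F]_s) :
  reflect (forall i j : 'I_s, (j <= i)%N -> u i j = (i == j)%:R) (unitri u).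
Proof.
apply: (iffP forallP) => [Uu i j le_ji | Uu i].
  by move/(_ i)/forallP/(_ j)/implyP/(_ le_ji)/eqP: Uu.
by apply/forallP=> j; apply/implyP=> le_ji; rewrite Uu.
Qed.

Lemma unitri1 s : unitri (1%:M : 'M_s).
Proof. by apply/unitriP=> i j _; rewrite mxE. Qed.

Lemma unitri_det s (u : 'M_s) : unitri u -> \det u = 1.
Proof.
move/unitriP=> Uu; rewrite -det_tr det_trig => [|].
  by rewrite big1 // => i _; rewrite mxE Uu // eqxx.
apply/is_trig_mxP=> i j lt_ij; rewrite mxE Uu 1?ltnW //.
by rewrite -val_eqE /= gtn_eqF.
Qed.

Lemma unitri_unit s (u : 'M_s) : unitri u -> u \in unitmx.
Proof. by move=> Uu; rewrite unitmxE unitri_det ?unitr1. Qed.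

Lemma unitriM s (u v : 'M_s) : unitri u -> unitri v -> unitri (u *m v).
Proof.
move=> /unitriP Uu /unitriP Uv; apply/unitriP=> i j le_ji.
rewrite mxE (bigD1 i) //= Uu // Uv // eqxx mul1r big1 ?addr0 // => k ne_ki.
have [lt_ki|le_ik] := ltnP k i.
  by rewrite Uu 1?ltnW // eq_sym (negPf ne_ki) mul0r.
rewrite [v _ _]Uv ?(leq_trans le_ji) //.
case: eqP => [eq_kj|]; last by rewrite mulr0.
by case/negP: ne_ki; rewrite -val_eqE /= eqn_leq le_ik eq_kj le_ji.
Qed.

(** Downward induction on the row index, since row i of a product involves only
    the rows of the right factor from i on. *)
Lemma unitriMl s (u v : 'M_s) : unitri u -> unitri (u *m v) = unitri v.
Proof.
move=> Uu; apply/idP/idP => [Uuv|]; last exact: unitriM.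
move: Uu Uuv => /unitriP Uu /unitriP Uuv; apply/unitriP=> i.
have [d] := ubnP (s - i); elim: d i => // d IHd i lt_d j le_ji.
rewrite -Uuv // mxE (bigD1 i) //= Uu // eqxx mul1r big1 ?addr0 // => k ne_ki.
have [lt_ki|le_ik] := ltnP k i.
  by rewrite Uu 1?ltnW // eq_sym (negPf ne_ki) mul0r.
have lt_ik : (i < k)%N by rewrite ltn_neqAle le_ik andbT eq_sym val_eqE.
rewrite IHd; first last.
- exact: leq_trans le_ji le_ik.
- by have := ltn_ord k; lia.
by rewrite -val_eqE /= gtn_eqF ?mulr0 // (leq_ltn_trans le_ji).
Qed.

Lemma superdiag_sumM s (u v : 'M_s) : unitri u -> unitri v ->
  superdiag_sum (u *m v) = superdiag_sum u + superdiag_sum v.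
Proof.
move=> /unitriP Uu /unitriP Uv; rewrite -big_split; apply: eq_bigr => i _ /=.
rewrite -big_split; apply: eq_bigr => j /= /eqP eq_j.
have ne_ij : j != i by rewrite -val_eqE /= eq_j gtn_eqF.
rewrite mxE (bigD1 i) //= (bigD1 j) //= (Uu i i) // (Uv j j) // !eqxx mul1r mulr1.
rewrite big1 ?addr0 1?addrC // => k /andP[ne_ki ne_kj].
have [lt_ki|le_ik] := ltnP k i.
  by rewrite Uu 1?ltnW // eq_sym (negPf ne_ki) mul0r.
have lt_ik : (i < k)%N by rewrite ltn_neqAle le_ik andbT eq_sym val_eqE.
by rewrite [v _ _]Uv ?eq_j // (negPf ne_kj) mulr0.
Qed.

(** Transposition with respect to the antidiagonal: the anti-automorphism that
    preserves both the unitriangular group and its generic character. *)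
Definition antitranspose s (g : 'M[F]_s) : 'M[F]_s :=
  \matrix_(i, j) g (rev_ord j) (rev_ord i).

Lemma antitransposeK s : involutive (@antitranspose s).
Proof. by move=> g; apply/matrixP=> i j; rewrite !mxE !rev_ordK. Qed.

Lemma antitransposeM s (g h : 'M_s) :
  antitranspose (g *m h) = antitranspose h *m antitranspose g.
Proof.
apply/matrixP=> i j; rewrite !mxE (reindex_inj rev_ord_inj).
by apply: eq_bigr => k _; rewrite !mxE mulrC.
Qed.

Lemma antitranspose_unit s (g : 'M_s) : g \in unitmx -> antitranspose g \in unitmx.
Proof.
move=> Ug; have := antitransposeM g (invmx g); rewrite mulmxV //.
suff -> : antitranspose 1%:M = 1%:M :> 'M_s by move/esym/mulmx1_unit=> [].
by apply/matrixP=> i j; rewrite !mxE (inj_eq rev_ord_inj) eq_sym.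
Qed.

Lemma antitranspose_unitri s (u : 'M_s) : unitri (antitranspose u) = unitri u.
Proof.
have imp v : unitri v -> unitri (@antitranspose s v).
  move=> /unitriP Uv; apply/unitriP=> i j le_ji; rewrite mxE Uv.
    by rewrite (inj_eq rev_ord_inj) eq_sym.
  by rewrite /= leq_sub2l.
by apply/idP/idP => /imp //; rewrite antitransposeK.
Qed.

Lemma superdiag_sum_antitranspose s (u : 'M_s) :
  superdiag_sum (antitranspose u) = superdiag_sum u.
Proof.
rewrite /superdiag_sum; under eq_bigr do rewrite big_mkcond.
under [RHS]eq_bigr do rewrite big_mkcond.
rewrite exchange_big (reindex_inj rev_ord_inj); apply: eq_bigr => i _.
rewrite (reindex_inj rev_ord_inj); apply: eq_bigr => j _; rewrite mxE !rev_ordK.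
congr (if _ then _ else _); have := ltn_ord i; have := ltn_ord j => /=; lia.
Qed.

Lemma unitri_first_col a (g : 'M_(1 + a)) : unitri g -> g *m first_col F a = first_col F a.
Proof.
move/unitriP=> Ug; rewrite -{1}[g]hsubmxK mul_row_col mulmx1 mulmx0 addr0.
apply/matrixP=> i j; rewrite ord1 mxE Ug ?leq0n // mxE.
by case: splitP => k eq_k; rewrite -val_eqE /= eq_k mxE ?ord1.
Qed.

Lemma unitri_mirabolic a (y : 'rV_a) (u : 'M_a) : unitri (mirabolic y u) = unitri u.
Proof.
apply/unitriP/unitriP => Uu i j le_ji.
  rewrite -(block_mxEdr 1%:M y 0 u) [LHS]Uu ?leq_add2l //.
move: le_ji; rewrite -[i]splitK -[j]splitK.
case: (split i) (split j) => i' [] j' /= le_ji.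
- by rewrite block_mxEul mxE !ord1 !eqxx.
- by move: le_ji; rewrite [i']ord1.
- by rewrite block_mxEdl mxE [j']ord1.
by rewrite block_mxEdr Uu.
Qed.

Lemma sum_unitri_mirabolic (V : nmodType) a (h : 'M[F]_(1 + a) -> V) :
  \sum_(g | unitri g) h g
  = \sum_(u : 'M[F]_a | unitri u) \sum_(y : 'rV[F]_a) h (mirabolic y u).
Proof.
rewrite pair_big_dep /=.
rewrite (reindex_onto (fun p : 'M_a * 'rV_a => mirabolic p.2 p.1)
                      (fun g => (drsubmx g, ursubmx g))) /=.
  apply: eq_bigl => -[u y] /=.
  by rewrite block_mxKdr block_mxKur eqxx !andbT unitri_mirabolic.
by move=> g /unitri_first_col/fix_first_colP.
Qed.

Lemma superdiag_sum_mirabolic a (y : 'rV[F]_(1 + a)) u :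
  superdiag_sum (mirabolic y u) = first_coord y + superdiag_sum u.
Proof.
rewrite /superdiag_sum (@big_split_ord _ _ _ 1) /= big_ord1; congr (_ + _).
  rewrite big_mkcond (@big_split_ord _ _ _ 1) /= big_ord1 add0r.
  rewrite -big_mkcond (big_pred1 (lshift a 0)) => [|j]; last by rewrite /= -[RHS]val_eqE.
  rewrite block_mxEur /first_coord -{2}[y]hsubmxK mul_row_col mulmx1 mulmx0 addr0.
  by rewrite mxE.
apply: eq_bigr => i _; rewrite big_mkcond (@big_split_ord _ _ _ 1) /= big_ord1 add0r.
rewrite [RHS]big_mkcond; apply: eq_bigr => j _.
by rewrite block_mxEdr.
Qed.

End Unitriangular.

Section WhittakerSum.

Variables (F : finFieldType) (C : numClosedFieldType) (psi : F -> C).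
Hypothesis psi_char : additive_character psi.

(** The iterated Fourier coefficients are one coefficient along the whole
    unitriangular group, whose elements are built row by row from the bottom. *)
Lemma whittakerE a (f : 'M[F]_(1 + a) -> C) :
  whittaker psi f = (#|[pred u : 'M[F]_(1 + a) | unitri u]|%:R)^-1
    * \sum_(u | unitri u) psi (- superdiag_sum u) * f u.
Proof.
elim: a f => [|a IHa] f.
  have u1 (u : 'M[F]_(1 + 0)) : unitri u = (u == 1%:M).
    apply/unitriP/eqP => [Uu|-> i j]; last by rewrite mxE.
    by apply/matrixP=> i j; rewrite Uu ?mxE // !ord1.
  rewrite (eq_card1 (x := 1%:M)) => [|u]; last by rewrite inE u1.
  rewrite invr1 mul1r (big_pred1 1%:M) // /superdiag_sum big_ord1 big_pred0 => [|j].
    by rewrite oppr0 addchar0 // mul1r.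
  by rewrite ord1.
have -> : #|[pred u : 'M[F]_(1 + (1 + a)) | unitri u]|
    = (#|[pred u : 'M[F]_(1 + a) | unitri u]| * #|F| ^ (1 + a))%N.
  rewrite -sum1_card (sum_unitri_mirabolic (fun=> 1%N)) -sum_nat_const.
  by apply: eq_bigr => u _; rewrite sum1_card card_mx mul1n.
rewrite [LHS]/= IHa natrM natrX invfM -mulrA; congr (_ * _).
rewrite [X in _ = _ * X]sum_unitri_mirabolic mulr_sumr.
apply: eq_bigr => u _; rewrite /whittaker_step mulrCA; congr (_ * _); rewrite mulr_sumr.
apply: eq_bigr => y _; rewrite superdiag_sum_mirabolic opprD addcharD // mulrA.
by congr (_ * _); rewrite mulrC.
Qed.

End WhittakerSum.

(** * Bruhat decomposition *)

Section Bruhat.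

Variables (F : finFieldType) (s : nat).
Implicit Types (A B : 'M[F]_s) (a b i j k l : 'I_s).

(** Column l and the row of its pivot p are zero except where they cross; when
    this holds for every l, B is monomial. *)
Definition cleared_col B (l : 'I_s) : Prop :=
  exists p : 'I_s, forall k l', (k == p) != (l' == l) -> B k l' = 0.

Lemma unitri_add (x : 'cV[F]_s) (y : 'rV[F]_s) :
    (forall i j : 'I_s, (j <= i)%N -> x i 0 * y 0 j = 0) ->
  unitri (1%:M + x *m y).
Proof.
by move=> xy0; apply/unitriP=> i j le_ji; rewrite !mxE big_ord1 xy0 ?addr0.
Qed.

Lemma unit_col_neq0 B (j : 'I_s) : B \in unitmx -> exists i, B i j != 0.
Proof.
move=> UB; apply/existsP; apply: contraTT UB; rewrite negb_exists => /forallP B0.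
rewrite unitmxE unitfE negbK (expand_det_col _ j) big1 // => i _.
by move/(_ i): B0; rewrite negbK => /eqP ->; rewrite mul0r.
Qed.

(** One pivot: the lowest nonzero entry of column j clears the entries above
    it by upper row operations and those to its right by upper column
    operations, and this leaves the cleared columns as they are. *)
Lemma bruhat_step B (j : 'I_s) : B \in unitmx ->
    (forall l : 'I_s, (l < j)%N -> cleared_col B l) ->
  exists u1 u2, [/\ unitri u1, unitri u2 &
    forall l : 'I_s, (l <= j)%N -> cleared_col (u1 *m B *m u2) l].
Proof.
move=> UB clB; have [i0 nz_i0] := unit_col_neq0 j UB.
case: (@arg_maxnP _ i0 (fun i => B i j != 0) val) => // i nz_ij max_i.
have below a : (i < a)%N -> B a j = 0.
  by move=> lt_ia; apply/eqP; apply: contraTT lt_ia => /max_i; rewrite -leqNgt.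
(* The multipliers of the row operations, then of the column operations. *)
pose x : 'cV[F]_s := \col_a (if (a < i)%N then - B a j / B i j else 0).
pose y : 'rV[F]_s := \row_b (if (j < b)%N then - B i b / B i j else 0).
exists (1%:M + x *m delta_mx 0 i), (1%:M + delta_mx j 0 *m y).
set B1 := _ *m B; set B2 := B1 *m _.
have B1E a b : B1 a b = B a b + x a 0 * B i b.
  by rewrite /B1 mulmxDl mul1mx mxE -mulmxA -rowE !mxE big_ord1 !mxE.
have B2E a b : B2 a b = B1 a b + B1 a j * y 0 b.
  by rewrite /B2 mulmxDr mulmx1 mxE mulmxA -colE !mxE big_ord1 !mxE.
have xi : x i 0 = 0 by rewrite mxE ltnn.
have B1i b : B1 i b = B i b by rewrite B1E xi mul0r addr0.
have B1j a : a != i -> B1 a j = 0.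
  move=> ne_ai; rewrite B1E mxE; case: ltngtP => [lt_ai|lt_ia|/val_inj eq_ai].
  - by rewrite divfK ?subrr.
  - by rewrite mul0r addr0 below.
  by rewrite eq_ai eqxx in ne_ai.
have B2a a b : a != i -> B2 a b = B1 a b.
  by move=> ne_ai; rewrite B2E B1j // mul0r addr0.
have pivot_neq p l : (l < j)%N ->
    (forall k l', (k == p) != (l' == l) -> B k l' = 0) -> i != p.
  move=> lt_lj clp; apply: contra_neq nz_ij => eq_ip; apply: clp.
  by rewrite eq_ip eqxx -val_eqE /= gtn_eqF.
have clB_i l : (l < j)%N -> B i l = 0.
  move=> lt_lj; have [p clp] := clB l lt_lj.
  by rewrite clp // eqxx (negPf (pivot_neq _ _ lt_lj clp)).
have B2i b : b != j -> B2 i b = 0.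
  move=> ne_bj; rewrite B2E !B1i mxE; case: ltngtP => [lt_jb|lt_bj|/val_inj eq_jb].
  - by rewrite mulrC divfK ?subrr.
  - by rewrite mulr0 addr0 clB_i.
  by rewrite eq_jb eqxx in ne_bj.
split.
- apply: unitri_add => a b le_ba; rewrite !mxE eqxx /=.
  case: ltnP => [lt_ai|]; rewrite ?mul0r //.
  by rewrite -val_eqE /= ltn_eqF ?mulr0 // (leq_ltn_trans le_ba).
- apply: unitri_add => a b le_ba; rewrite !mxE eqxx andbT.
  case: ltnP => [lt_jb|]; rewrite ?mulr0 //.
  by rewrite -val_eqE /= gtn_eqF ?mul0r // (leq_trans lt_jb).
move=> l; rewrite leq_eqVlt => /orP[/eqP/val_inj->|lt_lj].
  exists i => k l'; have [->|ne_ki] := eqVneq k i => /=.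
    by case: (eqVneq l' j) => // ? _; apply: B2i.
  by case: (eqVneq l' j) => // -> _; rewrite B2a ?B1j.
have [p clp] := clB l lt_lj; exists p => k l' kl'.
have ne_ip := pivot_neq _ _ lt_lj clp.
have ne_lj : l != j by rewrite -val_eqE /= ltn_eqF.
have [eq_ki|ne_ki] := eqVneq k i.
  move: kl'; rewrite eq_ki (negPf ne_ip); case: (eqVneq l' l) => // -> _.
  exact: B2i.
rewrite B2a // B1E clp // add0r; have [eq_l|ne_l'l] := eqVneq l' l.
  by rewrite eq_l clB_i ?mulr0.
have -> : k = p.
  by have [//|ne_kp] := eqVneq k p; move: kl'; rewrite (negPf ne_kp) (negPf ne_l'l).
have Bpj : B p j = 0 by apply: clp; rewrite eqxx [j == l]eq_sym (negPf ne_lj).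
by rewrite mxE Bpj oppr0 mul0r if_same mul0r.
Qed.

Lemma bruhat A : A \in unitmx ->
  exists u1 u2, [/\ unitri u1, unitri u2 & forall l, cleared_col (u1 *m A *m u2) l].
Proof.
move=> UA.
have: forall m, (m <= s)%N -> exists u1 u2, [/\ unitri u1, unitri u2 &
    forall l, (l < m)%N -> cleared_col (u1 *m A *m u2) l].
  elim=> [|m IHm] lt_ms; first by exists 1%:M, 1%:M; split=> //; apply: unitri1.
  have [u1 [u2 [U1 U2 cl]]] := IHm (ltnW lt_ms).
  have UB : u1 *m A *m u2 \in unitmx by rewrite !unitmx_mul UA !unitri_unit.
  have [v1 [v2 [V1 V2 cl']]] := bruhat_step (j := Ordinal lt_ms) UB cl.
  exists (v1 *m u1), (u2 *m v2); split; rewrite ?unitriM // => l.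
  by move/cl'; rewrite !mulmxA.
by case/(_ s (leqnn s))=> u1 [u2 [U1 U2 cl]]; exists u1, u2; split=> // l; apply: cl.
Qed.

End Bruhat.

(** * Monomial matrices compatible with a generic character *)

Section AdmissibleMonomial.

Variables (F : finFieldType) (C : numClosedFieldType) (psi : F -> C).
Hypothesis psi_char : additive_character psi.
Hypothesis psi_neq1 : exists x : F, psi x != 1.

Definition transvection s (a b : 'I_s) (c : F) : 'M[F]_s :=
  1%:M + delta_mx a 0 *m (c *: delta_mx 0 b : 'rV_s).

Lemma transvection_unitri s (a b : 'I_s) c : (a < b)%N -> unitri (transvection a b c).
Proof.
move=> lt_ab; apply: unitri_add => i j le_ji; rewrite !mxE eqxx andbT /=.
have [eq_i|_] := eqVneq i a; last by rewrite mul0r.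
have [eq_j|_] := eqVneq j b; last by rewrite !mulr0.
by move: le_ji; rewrite eq_i eq_j leqNgt lt_ab.
Qed.

Lemma superdiag_sum_transvection s (a b : 'I_s) c :
  superdiag_sum (transvection a b c) = if b == a.+1 :> nat then c else 0.
Proof.
rewrite /superdiag_sum (bigD1 a) //= [X in _ + X]big1 ?addr0 => [|i ne_ia].
  rewrite big_mkcond (bigD1 b) //= big1 ?addr0 => [|j ne_jb].
    case: eqP => // eq_b; rewrite !mxE big_ord1 !mxE !eqxx mulr1 mul1r.
    by rewrite -val_eqE /= eq_b ltn_eqF // add0r.
  case: eqP => // eq_j; rewrite !mxE big_ord1 !mxE (negPf ne_jb) !mulr0 addr0.
  by rewrite -val_eqE /= eq_j ltn_eqF.
rewrite big1 // => j /eqP eq_j; rewrite !mxE big_ord1 !mxE (negPf ne_ia) mul0r addr0.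
by rewrite -val_eqE /= eq_j ltn_eqF.
Qed.

Section Monomial.

Variables (s : nat) (B : 'M[F]_s) (p : 'I_s -> 'I_s).
Hypothesis UB : B \in unitmx.
Hypothesis pP : forall l k l', (k == p l) != (l' == l) -> B k l' = 0.
Hypothesis B_adm : forall u v : 'M_s, unitri u -> unitri v ->
  B *m u = v *m B -> psi (superdiag_sum u) = psi (superdiag_sum v).

Lemma pivot_neq0 l : B (p l) l != 0.
Proof.
have [i nz] := unit_col_neq0 l UB; have [<- //|ne_ip] := eqVneq i (p l).
by case/eqP: nz; apply: (pP (l := l)); rewrite eqxx (negPf ne_ip).
Qed.

Lemma pivot_inj : injective p.
Proof.
move=> l l' eq_p; apply/eqP; apply: contraNT (pivot_neq0 l') => ne_l.
by rewrite -eq_p; apply/eqP/(pP (l := l)); rewrite eqxx [l' == l]eq_sym (negPf ne_l).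
Qed.

(** The transvection carried by the columns j0, j1 to the rows of their
    pivots: a character compatible with B must take the same value on both. *)
Lemma pivot_ascent (j0 j1 : 'I_s) : j1 = j0.+1 :> nat -> (p j0 < p j1)%N ->
  p j1 = (p j0).+1 :> nat /\ B (p j0) j0 = B (p j1) j1.
Proof.
move=> eq_j lt_p; set t0 := B (p j0) j0; set t1 := B (p j1) j1.
have nz_t1 : t1 != 0 := pivot_neq0 j1.
have colB : B *m delta_mx j0 0 = t0 *: delta_mx (p j0) 0 :> 'cV_s.
  rewrite -colE; apply/matrixP=> i k; rewrite !ord1 !mxE eqxx andbT.
  have [->|ne_i] := eqVneq i (p j0); first by rewrite mulr1.
  by rewrite mulr0; apply: (pP (l := j0)); rewrite eqxx (negPf ne_i).
have rowB : delta_mx 0 (p j1) *m B = t1 *: delta_mx 0 j1 :> 'rV_s.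
  rewrite -rowE; apply/matrixP=> k j; rewrite !ord1 !mxE eqxx /=.
  have [->|ne_j] := eqVneq j j1; first by rewrite mulr1.
  by rewrite mulr0; apply: (pP (l := j1)); rewrite eqxx (negPf ne_j).
(* Conjugation by B turns the transvection of parameter x into one of parameter
   x t0 / t1, which meets the superdiagonal only if the pivots are adjacent. *)
have psiE x : psi x = psi (if p j1 == (p j0).+1 :> nat then x * (t0 / t1) else 0).
  have lt_j : (j0 < j1)%N by rewrite eq_j.
  have := B_adm (transvection_unitri x lt_j) (transvection_unitri (x * (t0 / t1)) lt_p).
  rewrite !superdiag_sum_transvection eq_j eqxx; apply.
  rewrite mulmxDr mulmxDl mulmx1 mul1mx mulmxA colB -mulmxA -!scalemxAl rowB.
  by rewrite !scalemxAr !scalerA mulrA [t0 * x]mulrC divfK.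
have [x nt_x] := psi_neq1.
have eq_p : p j1 = (p j0).+1 :> nat.
  by apply/eqP; apply: contraNT nt_x => /negPf ne_p; rewrite psiE ne_p addchar0.
split=> //; apply/eqP; rewrite -/t0 -/t1 -subr_eq0; apply: contraT => nz_t.
have nz_c : 1 - t0 / t1 != 0.
  by rewrite -(inj_eq (mulIf nz_t1)) mul0r mulrBl mul1r divfK // -opprB oppr_eq0.
have [y] := exists_addchar_scale psi_neq1 nz_c.
by rewrite mulrBr mulr1 addcharD // psiE eq_p eqxx mulrC addcharNl ?eqxx.
Qed.

End Monomial.

(** By [pivot_ascent], pivots that move down from one column to the next do so
    by one step and with equal entries, so the permutation followed by the reversal of
    the indices has only unit descents. Being then an involution that preserves
    the entries means exactly that B is fixed by the antitranspose. *)
Lemma admissible_monomial s (B : 'M[F]_s) : B \in unitmx ->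
    (forall l, cleared_col B l) ->
    (forall u v : 'M_s, unitri u -> unitri v ->
       B *m u = v *m B -> psi (superdiag_sum u) = psi (superdiag_sum v)) ->
  antitranspose B = B.
Proof.
case: s B => [|s] B UB clB B_adm; first by rewrite [LHS]flatmx0 [RHS]flatmx0.
have [p pP] := fin_all_exists clB.
(* Functions on natural numbers, of which only the values below s.+1 matter:
   there inord is a section of the coercion to nat. *)
pose f i := rev_ord (p (inord i)) : nat; pose t i : F := B (p (inord i)) (inord i).
have f_lt i : (i < s.+1)%N -> (f i < s.+1)%N by move=> _; apply: ltn_ord.
have f_inj i j : (i < s.+1)%N -> (j < s.+1)%N -> f i = f j -> i = j.
  move=> lt_i lt_j /val_inj/rev_ord_inj/(pivot_inj UB pP) eq_ij.
  by rewrite -(inordK lt_i) eq_ij inordK.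
have f_descent i : (i.+1 < s.+1)%N -> (f i.+1 < f i)%N ->
    f i = (f i.+1).+1 /\ t i = t i.+1.
  move=> lt_i lt_f; have lt_i' := ltnW lt_i.
  have [||eq_p eq_t] := pivot_ascent UB pP B_adm (j0 := inord i) (j1 := inord i.+1).
  - by rewrite !inordK.
  - by move: lt_f; rewrite /f /= ; have := ltn_ord (p (inord i)); lia.
  split=> //; rewrite /f /= eq_p.
  by have := ltn_ord (p (inord i.+1)); lia.
have rev_inv := block_reversal f_lt f_inj f_descent.
pose h (j : 'I_s.+1) : 'I_s.+1 := rev_ord (p j).
have fh (j : 'I_s.+1) : f j = h j by rewrite /f inord_val.
have hK j : h (h j) = j.
  by apply: ord_inj; rewrite -fh -fh; case: (rev_inv j (ltn_ord j)).
have th j : B (p (h j)) (h j) = B (p j) j.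
  by have [_] := rev_inv j (ltn_ord j); rewrite fh /t !inord_val.
apply/matrixP=> i j; rewrite mxE.
have [->|ne_i] := eqVneq i (p j).
  by rewrite -[RHS]th -/(h j) -{1}[j]hK /h rev_ordK.
rewrite [RHS](pP j); last by rewrite eqxx (negPf ne_i).
apply: (pP (rev_ord i)); rewrite eqxx eqb_id.
apply: contraNneq ne_i => eq_j.
rewrite -[i]rev_ordK -(inj_eq rev_ord_inj) rev_ordK -/(h j) -[rev_ord i]hK.
by rewrite /h -eq_j rev_ordK.
Qed.

End AdmissibleMonomial.

(** * Multiplicity one for the generic character *)

Section Idempotents.

Variables (K : fieldType) (d : nat).

Lemma idempotent_factor (e : 'M[K]_d) : e *m e = e ->
  exists (c : 'M_(d, \rank e)) (r : 'M_(\rank e, d)), e = c *m r /\ r *m c = 1%:M.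
Proof.
move=> ee; have [B Bc] := row_fullP (col_base_full e).
have [B' rB] := row_freeP (row_base_free e).
exists (col_base e), (row_base e); split; first by rewrite mulmx_base.
move: (col_base e) (row_base e) (mulmx_base e) B B' Bc rB => c r.
move: (\rank e) c r => k c r crE B B' Bc rB.
have := congr1 (fun X => B *m X *m B') ee.
by rewrite -crE !mulmxA Bc !mul1mx -!mulmxA rB mulmx1.
Qed.

Lemma idempotent_trace (e : 'M[K]_d) : e *m e = e -> \tr e = (\rank e)%:R.
Proof.
case/idempotent_factor=> c [r [eE rc]].
by rewrite {1}eE mxtrace_mulC rc mxtrace1.
Qed.

(** The corner algebra cut out by an idempotent of rank r is the algebra of
    matrices of size r, which is commutative only if r is at most 1. *)
Lemma idempotent_commutative_rank (e : 'M[K]_d) : e *m e = e ->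
    (forall X Y, e *m X *m e *m (e *m Y *m e) = e *m Y *m e *m (e *m X *m e)) ->
  (\rank e <= 1)%N.
Proof.
case/idempotent_factor; move: (\rank e) => k c [r [-> rc]] e_comm.
have comm (A A' : 'M[K]_k) : A *m A' = A' *m A.
  have corner (X Y : 'M[K]_k) : r *m (c *m r *m (c *m X *m r) *m (c *m r)
      *m (c *m r *m (c *m Y *m r) *m (c *m r))) *m c = X *m Y.
    have idl m (Z : 'M[K]_(k, m)) : r *m (c *m Z) = Z by rewrite mulmxA rc mul1mx.
    by rewrite -!mulmxA !idl rc mulmx1.
  by rewrite -corner e_comm corner.
rewrite leqNgt; apply/negP => lt1; pose i0 := Ordinal (ltnW lt1); pose i1 := Ordinal lt1.
have /matrixP/(_ i0 i0)/eqP := comm (delta_mx i0 i1) (delta_mx i1 i0).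
by rewrite !mul_delta_mx !mxE !eqxx /= oner_eq0.
Qed.

End Idempotents.

Section WhittakerIdempotent.

Variables (F : finFieldType) (C : numClosedFieldType) (psi : F -> C).
Hypothesis psi_char : additive_character psi.
Hypothesis psi_neq1 : exists x : F, psi x != 1.

Variables (s d : nat) (rho : 'M[F]_s -> 'M[C]_d).
Hypothesis rhoM : forall g h, g \in unitmx -> h \in unitmx ->
  rho (g *m h) = rho g *m rho h.

(** The projector on the vectors on which the unitriangular group acts through
    the generic character; its rank is the multiplicity of that character. *)
Definition whittaker_idem : 'M[C]_d :=
  (#|[pred u : 'M[F]_s | unitri u]|%:R)^-1
    *: \sum_(u | unitri u) psi (- superdiag_sum u) *: rho u.

Local Notation e := whittaker_idem.

Lemma superdiag_sum1 : superdiag_sum (1%:M : 'M[F]_s) = 0.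
Proof.
rewrite /superdiag_sum big1 // => i _; rewrite big1 // => j /eqP eq_j.
by rewrite mxE -val_eqE /= eq_j ltn_eqF.
Qed.

Lemma unitriMr (u v : 'M[F]_s) : unitri v -> unitri (u *m v) = unitri u.
Proof.
move=> Uv; rewrite -antitranspose_unitri antitransposeM unitriMl.
  exact: antitranspose_unitri.
by rewrite antitranspose_unitri.
Qed.

Lemma whittaker_idem_l v : unitri v -> rho v *m e = psi (superdiag_sum v) *: e.
Proof.
move=> Uv; rewrite -scalemxAr scalerA mulrC -scalerA; congr (_ *: _).
have vU := unitri_unit Uv; rewrite mulmx_sumr [in RHS](reindex (mulmx v)) /=; last first.
  by exists (mulmx (invmx v)) => u _; rewrite ?mulKmx ?mulKVmx.
rewrite scaler_sumr; apply: eq_big => [u | u Uu]; first by rewrite unitriMl.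
rewrite superdiag_sumM // scalerA opprD addcharD // mulrA [psi _ * psi _]mulrC addcharNl //.
by rewrite mul1r rhoM ?unitri_unit // scalemxAr.
Qed.

Lemma whittaker_idem_r v : unitri v -> e *m rho v = psi (superdiag_sum v) *: e.
Proof.
move=> Uv; rewrite -scalemxAl scalerA mulrC -scalerA; congr (_ *: _).
have vU := unitri_unit Uv; rewrite mulmx_suml [in RHS](reindex (mulmx^~ v)) /=; last first.
  by exists (mulmx^~ (invmx v)) => u _; rewrite ?mulmxK ?mulmxKV.
rewrite scaler_sumr; apply: eq_big => [u | u Uu]; first by rewrite unitriMr.
rewrite superdiag_sumM // scalerA opprD addcharD // mulrCA.
rewrite [psi (superdiag_sum v) * _]mulrC addcharNl //.
by rewrite mulr1 rhoM ?unitri_unit // scalemxAl.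
Qed.

Lemma card_unitri_neq0 : #|[pred u : 'M[F]_s | unitri u]|%:R != 0 :> C.
Proof. by rewrite pnatr_eq0 -lt0n; apply/card_gt0P; exists 1%:M; apply: unitri1. Qed.

Lemma whittaker_idemK : e *m e = e.
Proof.
rewrite {1}/whittaker_idem -scalemxAl mulmx_suml.
rewrite (eq_bigr (fun=> e)) => [|u Uu]; last first.
  by rewrite -scalemxAl whittaker_idem_l // scalerA addcharNl // scale1r.
by rewrite sumr_const -scaler_nat scalerA mulVf ?scale1r // card_unitri_neq0.
Qed.

Definition whittaker_corner (g : 'M[F]_s) : 'M[C]_d := e *m rho g *m e.
Local Notation E := whittaker_corner.

Lemma whittaker_cornerM u g v : unitri u -> g \in unitmx -> unitri v ->
  E (u *m g *m v) = (psi (superdiag_sum u) * psi (superdiag_sum v)) *: E g.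
Proof.
move=> Uu Ug Uv; have uU := unitri_unit Uu; have vU := unitri_unit Uv.
rewrite /whittaker_corner !rhoM ?unitmx_mul ?uU // !mulmxA whittaker_idem_r //.
rewrite -(mulmxA _ (rho v)) whittaker_idem_l //.
by move: whittaker_idem => e0; rewrite -scalemxAr -!scalemxAl scalerA mulrC.
Qed.

(** A double coset of the unitriangular group on which the two characters do
    not agree contributes nothing; by the Bruhat decomposition every other
    double coset contains a matrix equal to its antitranspose. *)
Lemma whittaker_corner_antitranspose g : g \in unitmx ->
  E (antitranspose g) = E g.
Proof.
move=> Ug; have [u1 [u2 [U1 U2 clB]]] := bruhat Ug.
set B := u1 *m g *m u2 in clB.
have UB : B \in unitmx by rewrite !unitmx_mul Ug !unitri_unit.
have nz (u v : 'M_s) : psi (superdiag_sum u) * psi (superdiag_sum v) != 0.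
  by rewrite mulf_neq0 // addchar_neq0.
have EB := whittaker_cornerM U1 Ug U2.
have aU1 := etrans (antitranspose_unitri u1) U1.
have aU2 := etrans (antitranspose_unitri u2) U2.
have EaB : E (antitranspose B)
    = (psi (superdiag_sum u1) * psi (superdiag_sum u2)) *: E (antitranspose g).
  rewrite /B !antitransposeM mulmxA whittaker_cornerM ?antitranspose_unit //.
  by rewrite !superdiag_sum_antitranspose mulrC.
apply: (scalerI (nz u1 u2)); rewrite -EaB -EB -/B.
have [adm|] := boolP [forall u : 'M_s, forall v : 'M_s,
    [==> unitri u, unitri v, B *m u == v *m B
     => psi (superdiag_sum u) == psi (superdiag_sum v)]].
  rewrite (admissible_monomial psi_char psi_neq1 UB clB) // => u v Uu Uv eqB.
  apply/eqP; move/forallP/(_ u)/forallP/(_ v): adm.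
  by rewrite Uu Uv eqB eqxx.
(* Otherwise B u = v B with psi(u) <> psi(v), so that psi(u) E(B) = psi(v) E(B)
   and E(B) = 0; the antitranspose of the relation gives the same for the
   antitranspose of B. *)
case/forallPn=> u /forallPn[v]; rewrite !negb_imply => /and4P[Uu Uv /eqP eqB ne_psi].
have vanish h (x y : 'M_s) : h \in unitmx -> unitri x -> unitri y -> h *m x = y *m h ->
    psi (superdiag_sum x) != psi (superdiag_sum y) -> E h = 0.
  move=> Uh Ux Uy eq_h; rewrite -subr_eq0 => ne_xy; apply: (scalerI ne_xy).
  rewrite scaler0 scalerBl; apply/eqP; rewrite subr_eq0; apply/eqP.
  have := whittaker_cornerM (unitri1 F s) Uh Ux.
  have := whittaker_cornerM Uy Uh (unitri1 F s).
  by rewrite mulmx1 superdiag_sum1 addchar0 // mulr1 mul1r -eq_h mul1mx => <- ->.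
rewrite (vanish B u v) // (vanish _ (antitranspose v) (antitranspose u)) //.
- exact: antitranspose_unit.
- by rewrite antitranspose_unitri.
- by rewrite antitranspose_unitri.
- by rewrite -!antitransposeM eqB.
by rewrite !superdiag_sum_antitranspose eq_sym.
Qed.

Lemma whittaker_corner_prod g h : g \in unitmx -> h \in unitmx ->
  E g *m E h = (#|[pred u : 'M[F]_s | unitri u]|%:R)^-1
    *: \sum_(u | unitri u) psi (- superdiag_sum u) *: E (g *m u *m h).
Proof.
move=> Ug Uh; rewrite /whittaker_corner !mulmxA -(mulmxA _ e e) whittaker_idemK.
rewrite {2}/whittaker_idem; move: whittaker_idem => e0.
rewrite -scalemxAr -!scalemxAl; congr (_ *: _).
rewrite mulmx_sumr !mulmx_suml; apply: eq_bigr => u Uu.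
have uU := unitri_unit Uu; rewrite -scalemxAr -!scalemxAl.
by rewrite rhoM ?unitmx_mul ?Ug // rhoM // !mulmxA.
Qed.

Lemma whittaker_corner_comm g h : g \in unitmx -> h \in unitmx ->
  E g *m E h = E h *m E g.
Proof.
move=> Ug Uh; have Ug' := antitranspose_unit Ug; have Uh' := antitranspose_unit Uh.
rewrite -[E h in RHS]whittaker_corner_antitranspose //.
rewrite -[E g in RHS]whittaker_corner_antitranspose //.
rewrite !whittaker_corner_prod //; congr (_ *: _).
rewrite (reindex_inj (inv_inj (@antitransposeK F s))) /=.
rewrite (eq_bigl _ _ (@antitranspose_unitri F s)); apply: eq_bigr => u Uu.
rewrite superdiag_sum_antitranspose; congr (_ *: _).
have Uu' := antitranspose_unit (unitri_unit Uu).
rewrite -whittaker_corner_antitranspose ?unitmx_mul ?Ug ?Uu' //.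
by rewrite !antitransposeM antitransposeK mulmxA.
Qed.

Hypothesis rho_span : forall X : 'M[C]_d, exists c : 'M[F]_s -> C,
  X = \sum_(g | g \in unitmx) c g *: rho g.

(** Gelfand's trick: the antitranspose reverses products but fixes every
    operator e rho(g) e, so these operators commute; by irreducibility they
    span the corner e M e of the full matrix algebra. *)
Lemma whittaker_idem_rank : (\rank e <= 1)%N.
Proof.
apply: (idempotent_commutative_rank whittaker_idemK) => X Y.
have [[c ->] [c' ->]] := (rho_span X, rho_span Y).
have cornerE (b : 'M[F]_s -> C) :
    e *m (\sum_(g | g \in unitmx) b g *: rho g) *m e = \sum_(g | g \in unitmx) b g *: E g.
  rewrite mulmx_sumr mulmx_suml; apply: eq_bigr => g _; rewrite /whittaker_corner.
  by move: whittaker_idem => e0; rewrite -scalemxAr -scalemxAl.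
rewrite !cornerE mulmx_suml; under eq_bigr do rewrite mulmx_sumr.
rewrite exchange_big mulmx_suml; apply: eq_bigr => h Uh /=.
rewrite mulmx_sumr; apply: eq_bigr => g Ug.
by rewrite -!scalemxAl -!scalemxAr whittaker_corner_comm // !scalerA mulrC.
Qed.

End WhittakerIdempotent.

(** * Unipotent values of irreducible cuspidal characters *)

Section CuspidalCharacter.

Variables (F : finFieldType) (C : numClosedFieldType) (psi : F -> C).
Hypothesis psi_char : additive_character psi.
Hypothesis psi_neq1 : exists x : F, psi x != 1.

Variables (m d : nat) (rG : mx_representation C 'GL_m[F] d).

Local Notation a := m.-1.

(** A total map, so that the representation can be evaluated on matrices; the
    identity is a default value at singular matrices. *)
Definition gl_elt (A : 'M[F]_(1 + a)) : {'GL_m[F]} := insubd (1%g : {'GL_m[F]}) A.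
Definition gl_repr (A : 'M[F]_(1 + a)) : 'M[C]_d := rG (gl_elt A).
Definition gl_char (A : 'M[F]_(1 + a)) : C := \tr (gl_repr A).

Lemma gl_eltK A : A \in unitmx -> GLval (gl_elt A) = A.
Proof. exact: insubdK. Qed.

Lemma GLvalK x : gl_elt (GLval x) = x.
Proof. by apply: val_inj; apply: gl_eltK; apply: GL_unit. Qed.

Lemma gl_reprM A B : A \in unitmx -> B \in unitmx ->
  gl_repr (A *m B) = gl_repr A *m gl_repr B.
Proof.
move=> UA UB; rewrite /gl_repr -repr_mxM ?inE //; congr (rG _); apply: val_inj.
rewrite -[LHS]/(GLval _) -[RHS]/(GLval (gl_elt A) *m GLval (gl_elt B)).
by rewrite !gl_eltK // unitmx_mul UA.
Qed.

Lemma gl_repr1 : gl_repr 1%:M = 1%:M.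
Proof.
rewrite /gl_repr -(repr_mx1 rG); congr (rG _); apply: val_inj.
by rewrite -[LHS]/(GLval _) gl_eltK ?unitmx1.
Qed.

Lemma gl_char_class : mirabolic_class gl_char.
Proof.
move=> y u y' u' Uu Uu'; rewrite /gl_char !gl_reprM ?mirabolic_unit //.
exact: mxtrace_mulC.
Qed.

Lemma pid_copid_mxE s (b : nat) (z : 'M[F]_s) i j :
  (pid_mx b *m z *m copid_mx b) i j = if (i < b <= j)%N then z i j else 0.
Proof.
have pidE : pid_mx b = diag_mx (\row_(l < s) (l < b)%:R) :> 'M[F]_s.
  apply/matrixP=> k l; rewrite !mxE -val_eqE /=.
  by case: (_ == _); rewrite /= ?mulr1n ?mulr0n.
have copidE : copid_mx b = diag_mx (\row_(l < s) (b <= l)%:R) :> 'M[F]_s.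
  rewrite /copid_mx pidE; apply/matrixP=> k l; rewrite !mxE.
  case: (k == l); rewrite ?mulr0n ?subr0 // !mulr1n.
  by case: ltnP; rewrite ?subrr ?subr0.
rewrite copidE pidE mul_diag_mx mul_mx_diag !mxE.
by case: ltnP => _ /=; case: leqP => _; rewrite ?mulr1 ?mulr0 ?mul1r ?mul0r.
Qed.

Lemma reshape_index2 b c i : (i < b + c)%N -> reshape_index [:: b; c] i = (b <= i)%N.
Proof.
move=> lt_i; rewrite /reshape_index /= !subn_eq0.
case: ltnP => //= le_bi; case: leqP => //; lia.
Qed.

(** The sum of the operators of a unipotent radical has its rows fixed by that
    radical, hence vanishes; so do its translates and their traces. *)
Lemma gl_char_cuspidal : (0 < m)%N -> cuspidal rG -> mirabolic_cuspidal gl_char.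
Proof.
move=> m_gt0 rG_cusp b y u /andP[b_gt0 b_le_a] Uu.
pose n (z : 'M[F]_(1 + a)) := 1%:M + pid_mx b *m z *m copid_mx b.
(* The radical is abelian: D z (1 - D) D w (1 - D) = 0. *)
have nD z w : n z *m n w = n (z + w).
  rewrite /n [LHS]mulmxDl mul1mx [X in _ + X = _]mulmxDr mulmx1.
  rewrite (mulmxDr _ z w) (mulmxDl (_ *m z)) !mulmxA.
  rewrite -(mulmxA _ (copid_mx b) (pid_mx b)) mul_copid_mx_pid; last by lia.
  by rewrite mulmx0 !mul0mx addr0 addrA addrAC.
have n0 : n 0 = 1%:M by rewrite /n mulmx0 mul0mx addr0.
have Un z : n z \in unitmx.
  by case: (mulmx1_unit (_ : n z *m n (- z) = 1%:M)); rewrite ?nD ?subrr.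
have Umir : mirabolic y u \in unitmx by rewrite mirabolic_unit.
suff sum0 : \sum_z gl_repr (n z) = 0.
  rewrite (eq_bigr (fun z => \tr (gl_repr (n z) *m gl_repr (mirabolic y u)))) => [|z _].
    by rewrite -raddf_sum -mulmx_suml sum0 mul0mx raddf0.
  by rewrite -gl_reprM.
have comp_c : is_composition m [:: b; (m - b)%N].
  by rewrite /is_composition /= addn0; lia.
apply/eqP; rewrite -submx0 -[X in (_ <= X)%MS](rG_cusp _ comp_c) //; apply/rfix_mxP=> x.
rewrite inE => /forallP Nx.
have xE : GLval x = n (GLval x).
  apply/matrixP=> i j; rewrite /n mxE pid_copid_mxE mxE.
  have lt_m (l : 'I_(1 + a)) : (l < b + (m - b))%N by have := ltn_ord l; lia.
  have /forallP/(_ j) := Nx i; rewrite !reshape_index2 //.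
  case: (ltnP i b) => [lt_ib|le_bi]; case: (leqP b j) => [le_bj|lt_jb] /=.
  - by move=> _; rewrite -val_eqE /= ltn_eqF ?add0r // (leq_trans lt_ib).
  - by move/eqP=> ->; rewrite addr0.
  - by move/eqP=> ->; rewrite addr0.
  by move/eqP=> ->; rewrite addr0.
have -> : rG x = gl_repr (n (GLval x)) by rewrite -xE /gl_repr GLvalK.
rewrite mulmx_suml [RHS](reindex_inj (addIr (GLval x))) /=.
by apply: eq_bigr => z _; rewrite -gl_reprM ?nD.
Qed.

Lemma gl_repr_span : mx_irreducible rG -> forall X : 'M[C]_d,
  exists c : 'M[F]_(1 + a) -> C, X = \sum_(g | g \in unitmx) c g *: gl_repr g.
Proof.
move=> irr X.
have /mx_abs_irrP[_ [c cE]] := group_closure_closed_field irr.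
exists (fun A => c (gl_elt A) X); rewrite {1}(cE X).
rewrite [RHS](reindex_onto (@GLval m F) gl_elt) => [|A UA]; last by rewrite gl_eltK.
apply: eq_big => [x | x _]; last by rewrite /gl_repr GLvalK.
by rewrite GLvalK eqxx andbT inE; apply/esym/GL_unit.
Qed.

(** The Whittaker constant of an irreducible cuspidal representation is 1: it
    is the rank of an idempotent, at most 1 by multiplicity one, and if it
    were 0 the character would vanish at the identity. *)
Lemma cuspidal_character g k : (0 < m)%N -> mx_irreducible rG -> cuspidal rG ->
    g *m first_col F a = first_col F a -> (g - 1%:M) ^+ k = 0 ->
  gl_char g = unipotent_value F C (1 + a) (\rank (g - 1%:M)).
Proof.
move=> m_gt0 irr cusp g_col nil_g; pose e := whittaker_idem psi gl_repr.
have chi_cusp := gl_char_cuspidal m_gt0 cusp.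
have chi_val := mirabolic_unipotent psi_char psi_neq1 gl_char_class chi_cusp.
rewrite (chi_val _ _ g_col nil_g).
have whE : whittaker psi gl_char = \tr e.
  rewrite whittakerE // /e mxtraceZ raddf_sum; congr (_ * _).
  by apply: eq_bigr => u _; rewrite /= mxtraceZ.
have e_idem := whittaker_idemK psi_char gl_reprM : e *m e = e.
have rk_e : (\rank e <= 1)%N.
  exact: (whittaker_idem_rank psi_char psi_neq1 gl_reprM (gl_repr_span irr)).
have d_neq0 : (d%:R : C) != 0.
  by rewrite pnatr_eq0 -lt0n; case/mx_irrP: irr.
have chi1 : gl_char 1%:M = d%:R by rewrite /gl_char gl_repr1 mxtrace1.
move: (chi_val 1%:M 1%N); rewrite mul1mx subrr expr1 chi1 => /(_ erefl erefl).
rewrite whE (idempotent_trace e_idem).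
case: (\rank e) rk_e => [|[|]] //= _ d_eq; last by rewrite mul1r.
by rewrite d_eq mul0r eqxx in d_neq0.
Qed.

End CuspidalCharacter.

(** * Dimension of the twisted Jacquet module *)

(** The span of all v r(X) - lam(X) v is the image of 1 - e, where e is the
    projector on the lam-isotypic part; the corank is therefore the rank of e,
    which is its trace. *)
Lemma isotypic_dim (F : finFieldType) (C : numClosedFieldType) (n d : nat)
    (r : 'M[F]_n -> 'M[C]_d) (lam : 'M[F]_n -> C) :
    (forall X Y, r (X + Y) = r X *m r Y) -> r 0 = 1%:M ->
    (forall X Y, lam (X + Y) = lam X * lam Y) -> lam 0 = 1 ->
  (d - \rank (\sum_X (r X - (lam X)%:M)%R)%MS)%:R
    = ((#|F|%:R : C) ^+ (n * n))^-1 * \sum_X lam (- X) * \tr (r X).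
Proof.
move=> rD r0 lamD lam0; set N := \rank _.
have lamN X : lam (- X) * lam X = 1 by rewrite -lamD addNr.
have nz_q : (#|F|%:R : C) ^+ (n * n) != 0 by rewrite expf_neq0 // card_field_neq0.
pose e : 'M[C]_d := (#|F|%:R ^+ (n * n))^-1 *: \sum_X lam (- X) *: r X.
have er X : r X *m e = lam X *: e.
  rewrite -scalemxAr scalerA mulrC -scalerA; congr (_ *: _).
  rewrite mulmx_sumr [in RHS](reindex_inj (addrI X)) scaler_sumr /=.
  apply: eq_bigr => Y _; rewrite opprD lamD scalerA mulrA [lam X * _]mulrC lamN mul1r.
  by rewrite -scalemxAr rD.
have sumc (V : lmodType C) (v : V) : \sum_(X : 'M[F]_n) v = (#|F|%:R : C) ^+ (n * n) *: v.
  by rewrite sumr_const card_mx -natrX scaler_nat.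
have ee : e *m e = e.
  rewrite {1}/e -scalemxAl mulmx_suml (eq_bigr (fun=> e)) => [|X _].
    by rewrite sumc scalerA mulVf // scale1r.
  by rewrite -scalemxAl er scalerA lamN scale1r.
have e1 : 1%:M - e = (#|F|%:R ^+ (n * n))^-1 *: \sum_X lam (- X) *: ((lam X)%:M - r X).
  rewrite (eq_bigr (fun X => 1%:M - lam (- X) *: r X)) => [|X _]; last first.
    by rewrite scalerBr scale_scalar_mx lamN.
  by rewrite sumrB sumc scalerBr scalerA mulVf // scale1r.
have -> : N = \rank (1%:M - e).
  apply/eqmx_rank/andP; split.
    apply/sumsmx_subP => X _; apply/submxP; exists (r X - (lam X)%:M).
    by rewrite mulmxBr mulmx1 mulmxBl er mul_scalar_mx subrr subr0.
  rewrite e1 scalemx_sub // summx_sub // => X _; rewrite scalemx_sub //.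
  by rewrite -opprB eqmx_opp (sumsmx_sup X).
have e1_idem : (1%:M - e) *m (1%:M - e) = 1%:M - e.
  by rewrite mulmxBr mulmx1 mulmxBl mul1mx ee subrr subr0.
rewrite natrB ?rank_leq_row // -(idempotent_trace e1_idem) raddfB /= mxtrace1.
rewrite opprB addrC subrK /e mxtraceZ raddf_sum; congr (_ * _).
by apply: eq_bigr => X _; rewrite /= mxtraceZ.
Qed.

Lemma split_ord_ind m1 m2 (P : 'I_(m1 + m2) -> Prop) :
  (forall i, P (lshift m2 i)) -> (forall i, P (rshift m1 i)) -> forall i, P i.
Proof. by move=> Pl Pr i; rewrite -[i]splitK; case: (split i). Qed.

Section BlockUnipotent.

Variables (F : finFieldType) (n' : nat).
Local Notation n := n'.+1.

Definition block_unip (X : 'M[F]_n) : 'M[F]_(n + n) := block_mx 1%:M X 0 1%:M.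

Lemma block_unipD X Y : block_unip (X + Y) = block_unip X *m block_unip Y.
Proof.
by rewrite /block_unip mulmx_block !mul1mx !mulmx1 !mulmx0 mul0mx !addr0 !add0r addrC.
Qed.

Lemma block_unip0 : block_unip 0 = 1%:M.
Proof. by rewrite /block_unip -scalar_mx_block. Qed.

Lemma block_unip_unit X : block_unip X \in unitmx.
Proof.
case: (mulmx1_unit (_ : block_unip X *m block_unip (- X) = 1%:M)) => //.
by rewrite -block_unipD subrr block_unip0.
Qed.

Lemma block_unip_sub1 X : block_unip X - 1%:M = block_mx 0 X 0 0.
Proof.
by rewrite scalar_mx_block opp_block_mx add_block_mx !subrr !subr0.
Qed.

Lemma block_unip_nilpotent X : (block_unip X - 1%:M) ^+ 2 = 0.
Proof.
rewrite block_unip_sub1 expr2 -[LHS]/(_ *m _) mulmx_block.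
by rewrite !mulmx0 !mul0mx !addr0 block_mx0.
Qed.

Lemma block_unip_rank X : \rank (block_unip X - 1%:M) = \rank X.
Proof. by rewrite block_unip_sub1 block_mxEv row_mx0 rank_col_mx0 rank_row_0mx. Qed.

Lemma block_unip_unitri X : unitri (block_unip X).
Proof.
apply/unitriP=> i j; rewrite -[i]splitK -[j]splitK.
case: (split i) (split j) => i' [] j' /= le_ji.
- by rewrite block_mxEul mxE (inj_eq (@lshift_inj _ _)).
- by have := ltn_ord i'; lia.
- by rewrite block_mxEdl mxE eq_rlshift.
by rewrite block_mxEdr mxE (inj_eq (@rshift_inj _ _)).
Qed.

Lemma inord_lshift (i : 'I_n) : inord i = lshift n i :> 'I_(n + n).-1.+1.
Proof. by apply: val_inj; rewrite /= inordK //=; have := ltn_ord i; lia. Qed.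

Lemma inord_rshift (j : 'I_n) : inord (n + j) = rshift n j :> 'I_(n + n).-1.+1.
Proof. by apply: val_inj; rewrite /= inordK //=; have := ltn_ord j; lia. Qed.

Lemma upper_right_block_unip (x : {'GL_(n + n)[F]}) X :
  GLval x = block_unip X -> upper_right x = X.
Proof.
move=> xE; apply/matrixP=> i j; rewrite mxE xE inord_lshift inord_rshift.
exact: block_mxEur.
Qed.

Lemma mem_unip_radical_block (x : {'GL_(n + n)[F]}) :
  (x \in unip_radical F (n + n) [:: n; n]) = (GLval x == block_unip (upper_right x)).
Proof.
have ri (i : 'I_(n + n)) : reshape_index [:: n; n] i = (n <= i)%N.
  exact: reshape_index2.
have lN (i : 'I_n) : (n <= lshift n i)%N = false.
  by apply/negbTE; rewrite -ltnNge; apply: (ltn_ord i).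
have rN (i : 'I_n) : (n <= rshift n i)%N = true by apply: leq_addr.
rewrite inE; apply/forallP/eqP => [Nx | xE i].
  have Nij (i j : 'I_(n + n)) :
      ((n <= i) < (n <= j))%N || (GLval x i j == (i == j)%:R).
    by have /forallP/(_ j) := Nx i; rewrite !ri.
  apply/matrixP=> i j; move: i j.
  apply: (@split_ord_ind n n) => i; apply: (@split_ord_ind n n) => j.
  - rewrite [RHS]block_mxEul mxE -(inj_eq (@lshift_inj n n)).
    by have := Nij (lshift n i) (lshift n j); rewrite !lN => /eqP.
  - by rewrite [RHS]block_mxEur mxE inord_lshift inord_rshift.
  - rewrite [RHS]block_mxEdl mxE; have := Nij (rshift n i) (lshift n j).
    by rewrite lN rN eq_rlshift => /eqP.
  rewrite [RHS]block_mxEdr mxE -(inj_eq (@rshift_inj n n)).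
  by have := Nij (rshift n i) (rshift n j); rewrite !rN => /eqP.
apply/forallP=> j; rewrite !ri xE; move: i j.
apply: (@split_ord_ind n n) => i; apply: (@split_ord_ind n n) => j; apply/orP.
- by right; rewrite [X in X == _]block_mxEul mxE (inj_eq (@lshift_inj n n)).
- by left; rewrite lN rN.
- right; rewrite [X in X == _]block_mxEdl mxE.
  rewrite [X in _ == (nat_of_bool X)%:R](_ : _ = false) ?eqxx //.
  exact: (@eq_rlshift n n i j).
by right; rewrite [X in X == _]block_mxEdr mxE (inj_eq (@rshift_inj n n)).
Qed.

End BlockUnipotent.

Lemma qpochhammer_sign (q : int) n :
  (-1) ^+ (n - 1) * qpochhammer q q (n - 1) = \prod_(1 <= i < n) (q ^+ i - 1).
Proof.
rewrite big_add1 -subn1 big_mkord -[X in _ ^+ X]card_ord -prodr_const -big_split.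
by apply: eq_bigr => i _; rewrite /= mulN1r opprB exprS.
Qed.

Theorem theorem3p4 (C : numClosedFieldType) (F : finFieldType) (n : nat)
  (n_gt0 : (0 < n)%N)
  (L : splittingFieldType F) (dimL : \dim {:L} = (n + n)%N)
  (theta : L -> C) (theta_reg : regular_character theta)
  (d : nat) (rG : mx_representation C 'GL_(n + n)[F] d)
  (rG_irr : mx_irreducible rG) (rG_cusp : cuspidal rG)
  (rG_theta : green_parameter rG theta)
  (psi0 : F -> C) (psi0_char : additive_character psi0)
  (psi0_neq1 : exists x : F, psi0 x != 1)
  (k : nat) (k_le_n : (k <= n)%N) :
  let q : int := #|F|%:Z in
  (twisted_jacquet_dim rG (unip_radical F (n + n) [:: n; n])
     (psi_mx psi0 (pid_mx k)))%:Z
  = (-1) ^+ (n - 1) * qpochhammer q q (n - 1) * q ^+ 'C(k, 2)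
    * \prod_(k <= i < n) (q ^+ i - 1).
Proof.
move=> q; case: n n_gt0 dimL d rG rG_irr rG_cusp rG_theta k_le_n => // n' _ _.
move=> d rG rG_irr rG_cusp _ k_le_n.
set n := n'.+1 in rG rG_irr rG_cusp k_le_n *.
pose r (X : 'M[F]_n) := gl_repr rG (block_unip X).
pose lam (X : 'M[F]_n) := psi0 (\tr (pid_mx k *m X)).
have psiN_char := addcharN_char psi0_char; have psiN_neq1 := addcharN_neq1 psi0_neq1.
have jacquetE : twisted_jacquet_dim rG (unip_radical F (n + n) [:: n; n])
     (psi_mx psi0 (pid_mx k)) = (d - \rank (\sum_X (r X - (lam X)%:M)%R)%MS)%N.
  rewrite /twisted_jacquet_dim /jacquet_span; congr (d - \rank _)%N.
  pose bl (X : 'M[F]_n) : {'GL_(n + n)[F]} := @gl_elt F (n + n) (block_unip X).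
  have blE X : GLval (bl X) = block_unip X by rewrite gl_eltK ?block_unip_unit.
  rewrite (reindex_onto bl (@upper_right F n)) => [|x].
    apply: eq_big => [X | X _].
      by rewrite mem_unip_radical_block (upper_right_block_unip (blE X)) blE !eqxx.
    by rewrite /r /lam /psi_mx (upper_right_block_unip (blE X)).
  rewrite mem_unip_radical_block => /eqP xE; apply: val_inj.
  by rewrite -[LHS]/(GLval _) blE -xE.
have dimC : (twisted_jacquet_dim rG (unip_radical F (n + n) [:: n; n])
     (psi_mx psi0 (pid_mx k)))%:R
   = (#|F|%:R : C) ^+ 'C(k, 2)
    * (\prod_(k <= i < n) (#|F|%:R ^+ i - 1) * \prod_(1 <= i < n) (#|F|%:R ^+ i - 1)).
  rewrite jacquetE isotypic_dim.
  - have nz_q : (#|F|%:R : C) ^+ (n * n) != 0 by rewrite expf_neq0 // card_field_neq0.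
    apply: (mulfI nz_q); rewrite mulrA divff // mul1r.
    rewrite -(rank_sum_pidE psiN_char psiN_neq1 (ltn0Sn n') k_le_n).
    apply: eq_bigr => X _; rewrite /lam mulmxN raddfN /=; congr (_ * _).
    rewrite -[LHS]/(gl_char rG (block_unip X)).
    rewrite (cuspidal_character psi0_char psi0_neq1 _ rG_irr rG_cusp _
      (block_unip_nilpotent X)) //.
      by rewrite block_unip_rank.
    by apply: unitri_first_col; apply: block_unip_unitri.
  - by move=> X Y; rewrite /r block_unipD gl_reprM ?block_unip_unit.
  - by rewrite /r block_unip0 gl_repr1.
  - by move=> X Y; rewrite /lam mulmxDr raddfD /= addcharD.
  by rewrite /lam mulmx0 raddf0 addchar0.
apply: (@intr_inj C); rewrite qpochhammer_sign -[LHS]/(_%:R) dimC.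
rewrite !rmorphM rmorphXn !rmorph_prod /= mulrA mulrC mulrA.
by congr (_ * _ * _); apply: eq_bigr => i _; rewrite rmorphB rmorphXn.
Qed.
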